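(* Let $G^-$ and $G^+$ be entire functions with $G^-(1/2)=G^+(1/2)$ and $(G^-)'(1/2)\ne(G^+)'(1/2)$, and let $g^\pm:\mathbb R\to\mathbb C$ be the continuous function $g^\pm(b)=G^-(b)$ for $b<1/2$, $g^\pm(b)=G^+(b)$ for $b\ge1/2$. Let $0<\eta<1/2$. Then there exist an open neighbourhood $V^-_\eta$ of $0$ in $\mathbb C$ and an open neighbourhood $V^+_\eta$ of $1$ in $\mathbb C$ such that for every $b'\in[-\eta,\eta]$ and every sequence $\boldsymbol\epsilon=(\epsilon_N)_{N\ge1}$ with $\epsilon_N\in[0,1)$, $\epsilon_N\to0$, the polynomials $$P_N(z)=\sum_{\nu=0}^N\binom N\nu z^\nu(1-z)^{N-\nu}\,g^\pm\Big(b'+\nu\,\frac{1-\epsilon_N}{N}\Big)$$ converge uniformly on every compact subset of $V^-_\eta$ to $z\mapsto G^-(z+b')$ and uniformly on every compact subset of $V^+_\eta$ to $z\mapsto G^+(z+b')$, the convergence being uniform with respect to $b'\in[-\eta,\eta]$. Moreover, if $\{\boldsymbol\epsilon_{\iota'}:\iota'\in I'\}$ is a family of such sequences with $\sup_{\iota'}\epsilon_{\iota',N}\to0$ as $N\to\infty$, then these convergences (with $\boldsymbol\epsilon_{\iota'}$ in place of $\boldsymbol\epsilon$) on compact subsets of $V^-_\eta$ and of $V^+_\eta$ are also uniform with respect to $\iota'$. *)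

(* Defs.v *)
(* MathComp-Analysis over an abstract R : realType;
   the complex plane is R[i] (mathcomp-real-closed), viewed through the
   regular-algebra alias R[i]^o, which carries the standard (modulus)
   normed-module / topological structure over the field R[i]. *)
From HB Require Import structures.
From mathcomp Require Import all_boot all_order all_algebra.
From mathcomp Require Import all_classical all_reals all_analysis.
From mathcomp Require Import complex.
Set Implicit Arguments. Unset Strict Implicit. Unset Printing Implicit Defensive.
Import Order.TTheory GRing.Theory Num.Theory.
Import numFieldNormedType.Exports.
Local Open Scope ring_scope.
Local Open Scope complex_scope.
Local Open Scope classical_set_scope.

Notation Cplx R := ((R[i])^o).

Definition RtoC (R : realType) (x : R) : Cplx R := x%:C.

Definition entire (R : realType) (G : Cplx R -> Cplx R) : Prop :=
  forall z : Cplx R, derivable G z 1.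

Definition gpm (R : realType) (Gm Gp : Cplx R -> Cplx R) (b : R) : Cplx R :=
  if b < 2^-1 then Gm (RtoC b) else Gp (RtoC b).

Definition PN (R : realType) (g : R -> Cplx R) (b' epsN : R) (N : nat)
  (z : Cplx R) : Cplx R :=
  \sum_(0 <= nu < N.+1)
    ('C(N, nu))%:R * z ^+ nu * (1 - z) ^+ (N - nu) *
      g (b' + nu%:R * ((1 - epsN) / N%:R)).

(* admissible sequence (eps_N)_{N>=1}: eps_N in [0,1), eps_N -> 0
   (the value at N = 0 is irrelevant and unconstrained) *)
Definition admissible_eps (R : realType) (eps : nat -> R) : Prop :=
  (forall N : nat, (0 < N)%N -> 0 <= eps N < 1) /\ (eps @ \oo --> 0%R).

(* sup_iota eps_iota,N -> 0 as N -> oo (all eps_iota,N are >= 0) *)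
Definition sup_to_0 (R : realType) (I : Type) (eps : I -> nat -> R) : Prop :=
  forall e : R, 0 < e -> exists N0 : nat, forall N : nat, (N0 <= N)%N ->
    forall i : I, eps i N <= e.

Definition unif_conv (R : realType) (I : Type) (g : R -> Cplx R)
  (eps : I -> nat -> R) (G : Cplx R -> Cplx R) (eta : R) (K : set (Cplx R))
  : Prop :=
  forall e : R, 0 < e -> exists N0 : nat, forall N : nat, (N0 <= N)%N ->
    forall b' : R, - eta <= b' <= eta -> forall i : I, forall z, K z ->
      `|PN g b' (eps i N) N z - G (z + RtoC b')| < RtoC e.

(* Main.v *)
(** Goursat's theorem, in the form of a bisection argument on dyadic midpoint
    sums over triangles, followed by Cauchy's formula on the square with vertices
    [+-4 +- 4i], gives [G z = \sum_k a_k z^k] with [|a_k| <= M / 4^k] for every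
    entire [G].  The Bernstein moments obey a recursion lowering the degree and
    [N] together, whence [B_N((b + t nu)^k)(z) = (b + N t z)^k] up to
    [O(k^2 2^k / N)]; summed against [a_k] this bounds the error of [P_N] by
    [O(1/N + eps_N)] when a single entire function is sampled.  For [z] near [0]
    (resp. [1]) the mass sits at [nu / N] near [0] (resp. [1]); sampling [g]
    instead of [G^-] (resp. [G^+]) only changes values at nodes bounded away from
    there, whose total weight is exponentially small. *)
Require Import Defs.
From HB Require Import structures.
From mathcomp Require Import all_boot all_order all_algebra.
From mathcomp Require Import all_classical all_reals all_analysis.
From mathcomp Require Import complex.
From mathcomp Require Import ring lra.
Import Order.TTheory GRing.Theory Num.Theory.
Import numFieldNormedType.Exports.
Local Open Scope ring_scope.
Local Open Scope classical_set_scope.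
Set Implicit Arguments. Unset Strict Implicit. Unset Printing Implicit Defensive.

(** For z off the segment [0, 1] the moduli of the Bernstein weights sum to (|z| + |1 - z|)^N, which
    grows exponentially, so Taylor remainders sampled at the nodes cannot be estimated term by term
    uniformly in N. Two devices avoid this: the error on monomials comes from an exact recursion in
    which the weights are never replaced by their moduli, and the Taylor degree tends to infinity
    while N stays fixed, so that constants depending badly on N disappear. In the tail the growth is
    really present and is beaten: on a small disc it is at most (3/2)^N after inserting a gain of
    2^N. The radii fit together as follows: |b| <= 1/2 and |z| <= 3/2 keep the nodes and z + b
    within modulus 2, while the boundary of the square has modulus at least 4, so a_k of size 4^-k
    outweighs the 2^k of the moments. No integral is constructed. Contour integrals appear only as
    limits of midpoint sums, and 2 pi i is replaced by the limit A of the sums of 1/z, of which only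
    |A| >= 4 is used. *)

Local Notation cabs := Normc.normc.

(** * Modulus, completeness and bisection *)

Lemma normE (R : realType) (z : Cplx R) : `|z| = RtoC (cabs z).
Proof. by case: z. Qed.

Lemma cabs_ge0 (R : realType) (z : Cplx R) : 0 <= cabs z.
Proof. by case: z => x y; rewrite sqrtr_ge0. Qed.

Lemma cabsM (R : realType) (x y : Cplx R) : cabs (x * y) = cabs x * cabs y.
Proof. exact: Normc.normcM. Qed.

Lemma cabsV (R : realType) (x : Cplx R) : cabs x^-1 = (cabs x)^-1.
Proof. exact: Normc.normcV. Qed.

Lemma cabsN (R : realType) (x : Cplx R) : cabs (- x) = cabs x.
Proof. exact: normcN. Qed.

Lemma cabsB (R : realType) (x y : Cplx R) : cabs (x - y) = cabs (y - x).
Proof. by rewrite -cabsN opprB. Qed.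

Lemma cabsD (R : realType) (x y : Cplx R) : cabs (x + y) <= cabs x + cabs y.
Proof. exact: le_normcD. Qed.

Lemma cabs_triangle (R : realType) (y x z : Cplx R) :
  cabs (x - z) <= cabs (x - y) + cabs (y - z).
Proof. by apply: le_trans (cabsD _ _); rewrite addrA subrK. Qed.

Lemma cabs0 (R : realType) : cabs (0 : Cplx R) = 0.
Proof. exact: Normc.normc0. Qed.

Lemma cabs1 (R : realType) : cabs (1 : Cplx R) = 1.
Proof. exact: Normc.normc1. Qed.

Lemma cabs_eq0 (R : realType) (x : Cplx R) : (cabs x == 0) = (x == 0).
Proof.
by apply/eqP/eqP => [/Normc.eq0_normc//|->]; rewrite cabs0.
Qed.

Lemma cabs_gt0 (R : realType) (x : Cplx R) : (0 < cabs x) = (x != 0).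
Proof. by rewrite lt_def cabs_ge0 andbT cabs_eq0. Qed.

Lemma cabsX (R : realType) (x : Cplx R) n : cabs (x ^+ n) = cabs x ^+ n.
Proof. by elim: n => [|n IH]; rewrite ?expr0 ?cabs1// !exprS cabsM IH. Qed.

Lemma cabs_real (R : realType) (x : R) : cabs (RtoC x) = `|x|.
Proof. by rewrite /= expr0n/= addr0 sqrtr_sqr. Qed.

Lemma cabs_nat (R : realType) n : cabs (n%:R : Cplx R) = n%:R.
Proof.
by have := cabs_real (n%:R : R); rewrite /RtoC rmorph_nat ger0_norm.
Qed.

Lemma cabs_half (R : realType) (x : Cplx R) : cabs (x / 2) = cabs x / 2.
Proof. by rewrite cabsM cabsV cabs_nat. Qed.

Lemma cabs_Re (R : realType) (z : Cplx R) : `|complex.Re z| <= cabs z.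
Proof.
case: z => x y /=; rewrite -(sqrtr_sqr x) ler_wsqrtr//.
by rewrite lerDl sqr_ge0.
Qed.

Lemma cabs_Im (R : realType) (z : Cplx R) : `|complex.Im z| <= cabs z.
Proof.
case: z => x y /=; rewrite -(sqrtr_sqr y) ler_wsqrtr//.
by rewrite lerDr sqr_ge0.
Qed.

Lemma cabs_ReIm (R : realType) (z : Cplx R) :
  cabs z <= `|complex.Re z| + `|complex.Im z|.
Proof.
case: z => x y /=.
rewrite -[leRHS]ger0_norm ?addr_ge0// -sqrtr_sqr ler_wsqrtr//.
rewrite sqrrD !real_normK ?num_real//.
by rewrite lerD2r lerDl mulrn_wge0// mulr_ge0.
Qed.

Lemma cabs_sum (R : realType) (I : Type) (r : seq I) (P : pred I)
    (F : I -> Cplx R) :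
  cabs (\sum_(i <- r | P i) F i) <= \sum_(i <- r | P i) cabs (F i).
Proof.
elim/big_ind2 : _ => [|x1 x2 y1 y2 h1 h2|//]; first by rewrite cabs0.
exact: le_trans (cabsD _ _) (lerD h1 h2).
Qed.

(** The limit is the supremum of the eventual lower bounds, that is, the lower limit of the
    sequence. *)
Lemma cauchy_real_limit (R : realType) (u : nat -> R) :
  (forall e : R, 0 < e -> exists n0 : nat,
     forall n, (n0 <= n)%N -> `|u n - u n0| <= e) ->
  exists l : R, forall e : R, 0 < e -> exists n0 : nat,
     forall n, (n0 <= n)%N -> `|u n - l| <= e.
Proof.
move=> cau.
pose A := [set x : R | exists n0 : nat, forall n, (n0 <= n)%N -> x <= u n].
have ubA e n0 : (forall n, (n0 <= n)%N -> `|u n - u n0| <= e) ->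
    ubound A (u n0 + e).
  move=> h x [n1 hx].
  have := hx (maxn n0 n1) (leq_maxr _ _).
  have := h (maxn n0 n1) (leq_maxl _ _).
  rewrite ler_norml => /andP[_ h1] h2; lra.
have inA e n0 : (forall n, (n0 <= n)%N -> `|u n - u n0| <= e) ->
    A (u n0 - e).
  by move=> h; exists n0 => n /h; rewrite ler_norml => /andP[h1 _]; lra.
have [n1 h1] := cau 1 ltr01.
have supA : has_sup A by split; [exists (u n1 - 1); exact: inA|
                                 exists (u n1 + 1); exact: ubA].
exists (sup A) => e e0.
have [n0 h0] := cau (e / 2) ltac:(lra).
have ge := sup_upper_bound supA (inA _ _ h0).
have le := ge_sup (proj1 supA) (ubA _ _ h0).
exists n0 => n /h0; rewrite !ler_norml => /andP[? ?]; apply/andP; split; lra.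
Qed.

Lemma cauchy_limit (R : realType) (u : nat -> Cplx R) :
  (forall e : R, 0 < e -> exists n0 : nat,
     forall n, (n0 <= n)%N -> cabs (u n - u n0) <= e) ->
  exists l : Cplx R, forall e : R, 0 < e -> exists n0 : nat,
     forall n, (n0 <= n)%N -> cabs (u n - l) <= e.
Proof.
move=> cau.
have [|a ha] := @cauchy_real_limit R (fun n => complex.Re (u n)).
  move=> e /cau[n0 h]; exists n0 => n /h; apply: le_trans.
  by rewrite -raddfB; exact: cabs_Re.
have [|b hb] := @cauchy_real_limit R (fun n => complex.Im (u n)).
  move=> e /cau[n0 h]; exists n0 => n /h; apply: le_trans.
  by rewrite -raddfB; exact: cabs_Im.
exists (Complex a b) => e e0.
have [na {}ha] := ha (e / 2) ltac:(lra).
have [nb {}hb] := hb (e / 2) ltac:(lra).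
exists (maxn na nb) => n; rewrite geq_max => /andP[/ha h1 /hb h2].
apply: le_trans (cabs_ReIm _) _; rewrite !raddfB/=; lra.
Qed.

(* Divide and conquer: if every failure of [P] is inherited by a piece of half
   the size, then [P] only has to be checked on small pieces near a point. *)
Lemma bisection (R : realType) (T : Type) (x : T -> Cplx R) (size : T -> R)
    (Q P : T -> Prop) :
  (forall t, 0 <= size t) ->
  (forall t, Q t -> ~ P t -> exists t', [/\ Q t', ~ P t',
     cabs (x t' - x t) <= size t & size t' = size t / 2]) ->
  (forall c, (forall d : R, 0 < d -> exists2 t, Q t & cabs (x t - c) < d) ->
     exists2 d : R, 0 < d & forall t, Q t -> cabs (x t - c) <= 2 * size t ->
       size t < d -> P t) ->
  forall t, Q t -> P t.
Proof.
move=> size0 step loc t0 Qt0; apply: contrapT => nPt0.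
pose S := {t : T | Q t /\ ~ P t}.
pose child (s s' : S) := cabs (x (sval s') - x (sval s)) <= size (sval s) /\
  size (sval s') = size (sval s) / 2.
have [|f [_ fS]] := @dependent_choice S child _ (exist _ t0 (conj Qt0 nPt0)).
  move=> [t [Qt nPt]]; apply: cid.
  have [t' [Qt' nPt' h1 h2]] := step _ Qt nPt.
  by exists (exist _ t' (conj Qt' nPt')).
pose u n := x (sval (f n)); pose s n := size (sval (f n)).
have sS n : s n.+1 = s n / 2 by have [] := fS n.
have uS n : cabs (u n.+1 - u n) <= s n by have [] := fS n.
have s_ge0 n : 0 <= s n by exact: size0.
(* Telescoped form of 1 + 1/2 + 1/4 + ... = 2, the source of the factor 2 in the local
   hypothesis. *)
have uD n k : cabs (u (n + k)%N - u n) <= 2 * s n - 2 * s (n + k)%N.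
  elim: k => [|k IH]; first by rewrite addn0 !subrr cabs0.
  have := cabs_triangle (u (n + k)%N) (u (n + k.+1)%N) (u n).
  have := uS (n + k)%N; have := sS (n + k)%N; rewrite addnS => h1 h2 h3.
  by rewrite h1; lra.
have uB n m : (n <= m)%N -> cabs (u m - u n) <= 2 * s n.
  move=> nm; have := uD n (m - n)%N; rewrite subnKC// => h.
  have := s_ge0 m; lra.
have s_small e : 0 < e -> exists n, s n < e.
  move=> e0.
  have sE n : s n * (n%:R + 1) <= s 0%N.
    elim: n => [|n IH]; first by rewrite add0r mulr1.
    rewrite sS -(natr1 n); apply: le_trans IH.
    rewrite -mulrA ler_wpM2l//; have := ler0n R n; lra.
  have := archi_boundP (divr_ge0 (s_ge0 0%N) (ltW e0)).
  move: (Num.bound _) => n hn; exists n; rewrite ltNge; apply/negP => en.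
  have := sE n; move: hn; rewrite ltr_pdivrMr//.
  have := ler_wpM2l (ler0n R n) en; have := s_ge0 n; lra.
have [|c hc] := cauchy_limit (u := u).
  move=> e e0; have [n hn] := s_small (e / 2) ltac:(lra).
  exists n => m /uB h; lra.
have uc n : cabs (u n - c) <= 2 * s n.
  apply/ler_addgt0Pl => e e0; have [n0 hn0] := hc _ e0.
  have := hn0 (maxn n0 n) (leq_maxl _ _).
  have := uB n (maxn n0 n) (leq_maxr _ _).
  have := cabs_triangle (u (maxn n0 n)) (u n) c.
  have := cabsB (u n) (u (maxn n0 n)); lra.
have [|d d0 hd] := loc c.
  move=> d d0; have [n hn] := s_small (d / 2) ltac:(lra).
  exists (sval (f n)); first by case: (svalP (f n)).
  apply: le_lt_trans (uc n) _; lra.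
have [n hn] := s_small _ d0.
have [Qn nPn] := svalP (f n).
exact: nPn (hd _ Qn (uc n) hn).
Qed.

Lemma nbhs_cabs (R : realType) (c : Cplx R) (P : set (Cplx R)) :
  (\forall z \near c, P z) <->
  exists2 d : R, 0 < d & forall z, cabs (z - c) < d -> P z.
Proof.
split.
  move=> /nbhs_normP[[d x]]; rewrite /= ltcE/= => /andP[/eqP -> d0] h.
  exists d => // z hz; apply: h => /=; rewrite normE.
  by rewrite cabsB ltcR.
move=> [d d0 h]; apply/nbhs_normP; exists (RtoC d); first by rewrite /= ltcR.
by move=> z; rewrite /= normE ltcR cabsB; exact: h.
Qed.

Lemma continuous_cabs (R : realType) (f : Cplx R -> Cplx R) (c : Cplx R) (e : R) :
  {for c, continuous f} -> 0 < e ->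
  exists2 d : R, 0 < d & forall z, cabs (z - c) < d -> cabs (f z - f c) <= e.
Proof.
move=> /cvgrPdist_le cf e0.
have e0' : 0 < RtoC e by rewrite ltcR.
have /nbhs_cabs[d d0 h] := cf _ e0'.
exists d => // z /h; by rewrite normE lecR cabsB.
Qed.

Lemma is_derive_cabs (R : realType) (f : Cplx R -> Cplx R) (c D : Cplx R) (e : R) :
  is_derive c 1 f D -> 0 < e ->
  exists2 d : R, 0 < d & forall z, cabs (z - c) < d ->
    cabs (f z - f c - D * (z - c)) <= e * cabs (z - c).
Proof.
move=> [df <-] e0.
have /cvgrPdist_le cf := df.
have e0' : 0 < RtoC e by rewrite ltcR.
have /nbhs_cabs[d d0 h] := cf _ e0'.
exists d => // z hz.
have [->|zc] := eqVneq z c; first by rewrite !subrr mulr0 subrr cabs0 mulr0.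
have zc0 : z - c != 0 by rewrite subr_eq0.
have := h (z - c); rewrite subr0 => /(_ hz zc0).
rewrite normE lecR /= /GRing.scale/= mulr1 subrK => {}h.
have -> : f z - f c - 'D_1 f c * (z - c) =
    - ((z - c) * ('D_1 f c - (z - c)^-1 * (f z - f c))) by field.
by rewrite cabsN cabsM mulrC ler_wpM2r ?cabs_ge0.
Qed.

(** * Midpoint sums along segments *)

Definition mid (R : realType) (a b : Cplx R) : Cplx R := (a + b) / 2.

Lemma midBl (R : realType) (a b : Cplx R) : mid a b - a = (b - a) / 2.
Proof. by rewrite /mid; field. Qed.

Lemma midBr (R : realType) (a b : Cplx R) : b - mid a b = (b - a) / 2.
Proof. by rewrite /mid; field. Qed.

Lemma midC (R : realType) (a b : Cplx R) : mid a b = mid b a.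
Proof. by rewrite /mid addrC. Qed.

(** Replaces convexity: the sums below evaluate only at iterated midpoints of the endpoints. *)
Definition midclosed (R : realType) (Q : set (Cplx R)) :=
  forall a b, Q a -> Q b -> Q (mid a b).

(** A single family of closed convex domains for all uses: [u = 0], [t = 0] gives the whole plane,
    and other choices contain a side of the square, or a triangle, while avoiding a singular
    point. *)
Definition halfplane (R : realType) (u : Cplx R) (t : R) : set (Cplx R) :=
  [set z | t <= complex.Re (u * z)].

Lemma Re_mid (R : realType) (u a b : Cplx R) :
  complex.Re (u * mid a b) = (complex.Re (u * a) + complex.Re (u * b)) / 2.
Proof.
have -> : u * mid a b = RtoC (2^-1) * (u * a + u * b).
  by rewrite /mid /RtoC fmorphV rmorph_nat; field.
by case: (u * a) (u * b) => [x y] [x' y'] /=; rewrite mul0r subr0 mulrC.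
Qed.

Lemma halfplane_mid (R : realType) (u : Cplx R) t : midclosed (halfplane u t).
Proof. by move=> a b; rewrite /halfplane/= Re_mid => ha hb; lra. Qed.

Lemma halfplane_closed (R : realType) (u c : Cplx R) t :
  (forall d : R, 0 < d -> exists2 z, halfplane u t z & cabs (z - c) < d) ->
  halfplane u t c.
Proof.
move=> h; rewrite /halfplane/=; apply/ler_addgt0Pr => e e0.
have u1 : 0 < cabs u + 1 by have := cabs_ge0 u; lra.
have [z hz zc] := h (e / (cabs u + 1)) (divr_gt0 e0 u1).
have : complex.Re (u * z) - complex.Re (u * c) <= e.
  rewrite -raddfB -mulrBr; apply: le_trans (ler_norm _) _.
  apply: le_trans (cabs_Re _) _; rewrite cabsM.
  move: zc; rewrite ltr_pdivlMr// => zc.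
  have := cabs_ge0 (z - c); have := cabs_ge0 u; nra.
by move: hz; rewrite /halfplane/=; lra.
Qed.

Lemma disc_mid (R : realType) (c : Cplx R) (r : R) :
  midclosed [set z | cabs (z - c) <= r].
Proof.
move=> a b /= ha hb; have -> : mid a b - c = (a - c + (b - c)) / 2.
  by rewrite /mid; field.
by rewrite cabs_half; have := cabsD (a - c) (b - c); lra.
Qed.

Lemma segment_bisection (R : realType) (u : Cplx R) (t : R)
    (P : Cplx R -> Cplx R -> Prop) :
  (forall a b, P a (mid a b) -> P (mid a b) b -> P a b) ->
  (forall c, halfplane u t c -> exists2 d : R, 0 < d &
     forall a b, halfplane u t a -> halfplane u t b ->
       cabs (a - c) <= 2 * cabs (b - a) -> cabs (b - a) < d -> P a b) ->
  forall a b, halfplane u t a -> halfplane u t b -> P a b.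
Proof.
move=> step loc a b Ha Hb.
pose x (s : Cplx R * Cplx R) := s.1.
pose size (s : Cplx R * Cplx R) := cabs (s.2 - s.1).
pose Q (s : Cplx R * Cplx R) := halfplane u t s.1 /\ halfplane u t s.2.
apply: (@bisection R _ x size Q (fun s => P s.1 s.2) _ _ _ (a, b)) => //.
- by move=> s; exact: cabs_ge0.
- move=> [p q] [/= Hp Hq] nP; have Hm := halfplane_mid Hp Hq.
  have [Pl|nPl] := pselect (P p (mid p q)).
    exists (mid p q, q); split => //=; first by move=> Pr; exact/nP/step.
      rewrite /x/= /size/= midBl cabs_half.
      by have := cabs_ge0 (q - p); lra.
    by rewrite /size/= midBr cabs_half.
  exists (p, mid p q); split => //=; first by rewrite subrr cabs0 cabs_ge0.
  by rewrite /size/= midBl cabs_half.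
- move=> c hc; have [|d d0 h] := loc c.
    by apply: halfplane_closed => d /hc[[p q] [Hp _]] ?; exists p.
  by exists d => // -[p q] [/= Hp Hq]; exact: h.
Qed.

Definition vanishing (R : realType) (x : nat -> Cplx R) :=
  forall e : R, 0 < e -> exists n0 : nat,
    forall n, (n0 <= n)%N -> cabs (x n) <= e.

(** Midpoint rule on 2^n equal pieces, approximating the integral of f along the segment. The
    recursion makes additivity under halving definitional, which is what every bisection uses. *)
Fixpoint msum (R : realType) (f : Cplx R -> Cplx R) (n : nat) (a b : Cplx R) :
    Cplx R :=
  if n is m.+1 then msum f m a (mid a b) + msum f m (mid a b) b
  else (b - a) * f (mid a b).

Lemma msumN (R : realType) (f : Cplx R -> Cplx R) n a b :
  msum f n b a = - msum f n a b.
Proof.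
elim: n a b => [|n IH] a b /=; first by rewrite midC; ring.
by rewrite (midC b a) (IH a) (IH _ b); ring.
Qed.

Lemma msumD (R : realType) (f g : Cplx R -> Cplx R) n a b :
  msum (fun z => f z + g z) n a b = msum f n a b + msum g n a b.
Proof. by elim: n a b => [|n IH] a b /=; rewrite ?IH; ring. Qed.

Lemma msumZ (R : realType) k (f : Cplx R -> Cplx R) n a b :
  msum (fun z => k * f z) n a b = k * msum f n a b.
Proof. by elim: n a b => [|n IH] a b /=; rewrite ?IH; ring. Qed.

Lemma msum_cst (R : realType) (k : Cplx R) n a b :
  msum (fun=> k) n a b = k * (b - a).
Proof. by elim: n a b => [|n IH] a b /=; rewrite ?IH; ring. Qed.

(** The midpoint rule is exact on affine functions, so their sums around a triangle vanish at every
    level and not only in the limit. *)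
Lemma msum_id (R : realType) n (a b : Cplx R) :
  msum id n a b = (b ^+ 2 - a ^+ 2) / 2.
Proof. by elim: n a b => [|n IH] a b /=; rewrite ?IH /mid; field. Qed.

Lemma eq_msum (R : realType) (Q : set (Cplx R)) (f g : Cplx R -> Cplx R) n a b :
  midclosed Q -> Q a -> Q b -> (forall z, Q z -> f z = g z) ->
  msum f n a b = msum g n a b.
Proof.
move=> mQ + + fg; elim: n a b => [|n IH] a b Qa Qb /=.
  by rewrite fg//; exact: mQ.
by rewrite !IH//; exact: mQ.
Qed.

Lemma cabs_msum_le (R : realType) (Q : set (Cplx R)) (f : Cplx R -> Cplx R)
    (k : R) n a b :
  midclosed Q -> Q a -> Q b -> (forall z, Q z -> cabs (f z) <= k) ->
  cabs (msum f n a b) <= k * cabs (b - a).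
Proof.
move=> mQ + + fk; elim: n a b => [|n IH] a b Qa Qb /=.
  by rewrite cabsM mulrC ler_wpM2r ?cabs_ge0 ?fk//; exact: mQ.
have Qm := mQ _ _ Qa Qb; apply: le_trans (cabsD _ _) _.
have := IH _ _ Qa Qm; have := IH _ _ Qm Qb.
by rewrite midBl midBr cabs_half; lra.
Qed.

Lemma msum_near (R : realType) (f : Cplx R -> Cplx R) c (e : R) :
  {for c, continuous f} -> 0 < e ->
  exists2 d : R, 0 < d & forall n a b,
    cabs (a - c) <= 2 * cabs (b - a) -> cabs (b - a) < d ->
    cabs (msum f n a b - (b - a) * f c) <= e * cabs (b - a).
Proof.
move=> cf e0; have [d d0 h] := continuous_cabs cf e0.
(* As a is within 2 |b - a| of c, both endpoints lie in the disc of radius 3 |b - a|. *)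
exists (d / 3); first lra.
move=> n a b hac hab.
have -> : msum f n a b - (b - a) * f c = msum (fun z => f z + - f c) n a b.
  by rewrite msumD msum_cst; ring.
apply: (@cabs_msum_le _ [set z | cabs (z - c) <= 3 * cabs (b - a)]).
- exact: disc_mid.
- by rewrite /=; have := cabs_ge0 (b - a); lra.
- by rewrite /=; have := cabs_triangle a b c; lra.
- by move=> z /= hz; apply: h; lra.
Qed.

Lemma eventually2 (P Q S : nat -> Prop) :
  (forall n, P n -> Q n -> S n) ->
  (exists n0 : nat, forall n, (n0 <= n)%N -> P n) ->
  (exists n0 : nat, forall n, (n0 <= n)%N -> Q n) ->
  exists n0 : nat, forall n, (n0 <= n)%N -> S n.
Proof.
move=> PQS [n1 h1] [n2 h2]; exists (maxn n1 n2) => n.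
by rewrite geq_max => /andP[/h1 ? /h2 ?]; exact: PQS.
Qed.

Lemma msum_cvg (R : realType) (u : Cplx R) t (f : Cplx R -> Cplx R) a b :
  (forall c, halfplane u t c -> {for c, continuous f}) ->
  halfplane u t a -> halfplane u t b ->
  exists l : Cplx R, vanishing (fun n => msum f n a b - l).
Proof.
move=> cf Ha Hb.
(* A bound proportional to the length is additive over the two halves, hence compatible with
   bisection. *)
suff main (e : R) : 0 < e -> exists n0 : nat, forall n m,
    (n0 <= n)%N -> (n0 <= m)%N ->
    cabs (msum f n a b - msum f m a b) <= e * cabs (b - a).
  apply: cauchy_limit => e e0.
  have p : 0 < cabs (b - a) + 1 by have := cabs_ge0 (b - a); lra.
  have [n0 h] := main _ (divr_gt0 e0 p).
  exists n0 => n n0n; apply: le_trans (h _ _ n0n (leqnn _)) _.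
  by rewrite mulrAC ler_pdivrMr// ler_wpM2l ?ltW//; lra.
move=> e0; move: a b Ha Hb; apply: segment_bisection.
  move=> a b [n1 h1] [n2 h2]; exists (maxn n1 n2).+1 => -[|n] [|m]//.
  rewrite !ltnS !geq_max => /andP[n1n n2n] /andP[n1m n2m] /=.
  rewrite opprD addrACA; apply: le_trans (cabsD _ _) _.
  have := h1 _ _ n1n n1m; have := h2 _ _ n2n n2m.
  by rewrite midBl midBr cabs_half; lra.
move=> c Hc; have e2 : 0 < e / 2 by lra.
have [d d0 h] := msum_near (cf _ Hc) e2.
exists d => // a b _ _ hac hab; exists 0%N => n m _ _.
have := cabs_triangle ((b - a) * f c) (msum f n a b) (msum f m a b).
have := h n _ _ hac hab; have := h m _ _ hac hab.
by have := cabsB ((b - a) * f c) (msum f m a b); lra.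
Qed.

Lemma msum_primitive (R : realType) (u : Cplx R) t (F f : Cplx R -> Cplx R) a b :
  (forall c, halfplane u t c -> {for c, continuous f}) ->
  (forall c, halfplane u t c -> is_derive c 1 F (f c)) ->
  halfplane u t a -> halfplane u t b ->
  vanishing (fun n => msum f n a b - (F b - F a)).
Proof.
move=> cf dF Ha Hb.
suff main (e : R) : 0 < e -> exists n0 : nat, forall n, (n0 <= n)%N ->
    cabs (msum f n a b - (F b - F a)) <= e * cabs (b - a).
  move=> e e0.
  have p : 0 < cabs (b - a) + 1 by have := cabs_ge0 (b - a); lra.
  have [n0 h] := main _ (divr_gt0 e0 p).
  exists n0 => n n0n; apply: le_trans (h _ n0n) _.
  by rewrite mulrAC ler_pdivrMr// ler_wpM2l ?ltW//; lra.
move=> e0; move: a b Ha Hb; apply: segment_bisection.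
  move=> a b [n1 h1] [n2 h2]; exists (maxn n1 n2).+1 => -[|n]//.
  rewrite !ltnS !geq_max => /andP[n1n n2n] /=.
  have -> : forall x y, x + y - (F b - F a) =
    (x - (F (mid a b) - F a)) + (y - (F b - F (mid a b))) by move=> *; ring.
  apply: le_trans (cabsD _ _) _.
  have := h1 _ n1n; have := h2 _ n2n.
  by rewrite midBl midBr cabs_half; lra.
(* 6 = 1 + 2 + 3: one share for the sum, and the distances of a and b to c are at most 2 and 3 times
   |b - a|. *)
move=> c Hc; have e6 : 0 < e / 6 by lra.
have [d d0 h] := msum_near (cf _ Hc) e6.
have [d' d'0 h'] := is_derive_cabs (dF _ Hc) e6.
exists (Num.min d (d' / 3)); first by rewrite lt_min; lra.
move=> a b _ _ hac; rewrite lt_min => /andP[hd hd']; exists 0%N => n _.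
have hbc : cabs (b - c) <= 3 * cabs (b - a).
  by have := cabs_triangle a b c; lra.
have := h n _ _ hac hd.
have := h' a ltac:(lra); have := h' b ltac:(lra).
have -> : msum f n a b - (F b - F a) = (msum f n a b - (b - a) * f c) +
  ((F a - F c - f c * (a - c)) - (F b - F c - f c * (b - c))) by ring.
move=> h1 h2 h3; apply: le_trans (cabsD _ _) _.
have := cabsD (F a - F c - f c * (a - c)) (- (F b - F c - f c * (b - c))).
by rewrite cabsN; nra.
Qed.

(** Bisection in place of compactness: bounds on two halves give one on the whole, and continuity
    bounds f on short segments. *)
Lemma segment_bounded (R : realType) (u : Cplx R) t (f : Cplx R -> Cplx R) a b :
  (forall c, halfplane u t c -> {for c, continuous f}) ->
  halfplane u t a -> halfplane u t b ->
  exists2 M : R, 0 < M & forall s : R, 0 <= s <= 1 ->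
    cabs (f (a + RtoC s * (b - a))) <= M.
Proof.
move=> cf; move: a b; apply: segment_bisection.
  have RtoC2 (s : R) : RtoC (2 * s) = 2 * RtoC s :> Cplx R.
    by rewrite /RtoC rmorphM rmorph_nat.
  move=> a b [M1 M10 h1] [M2 M20 h2].
  exists (M1 + M2); first lra.
  move=> s /andP[s0 s1]; have [s2|s2] := leP s (1 / 2).
    have := h1 (2 * s) ltac:(lra); rewrite midBl RtoC2.
    have -> : a + 2 * RtoC s * ((b - a) / 2) = a + RtoC s * (b - a) by field.
    lra.
  have := h2 (2 * s - 1) ltac:(lra).
  have -> : mid a b + RtoC (2 * s - 1) * (b - mid a b) = a + RtoC s * (b - a).
    have -> : RtoC (2 * s - 1) = 2 * RtoC s - 1 :> Cplx R.
      by rewrite /RtoC rmorphB rmorphM rmorph_nat rmorph1.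
    by rewrite midBr /mid; field.
  lra.
move=> c Hc; have [d d0 h] := continuous_cabs (cf _ Hc) ltr01.
exists (d / 3); first lra.
move=> a b _ _ hac hab; exists (cabs (f c) + 1).
  by have := cabs_ge0 (f c); lra.
move=> s /andP[s0 s1].
have hz : cabs (a + RtoC s * (b - a) - c) < d.
  have -> : a + RtoC s * (b - a) - c = a - c + RtoC s * (b - a) by ring.
  apply: le_lt_trans (cabsD _ _) _; rewrite cabsM cabs_real ger0_norm//.
  by have := cabs_ge0 (b - a); nra.
have := h _ hz; have := cabsD (f (a + RtoC s * (b - a)) - f c) (f c).
by rewrite subrK; lra.
Qed.

(** * Goursat's theorem *)

Definition tsum (R : realType) (f : Cplx R -> Cplx R) n (a b c : Cplx R) :=
  msum f n a b + msum f n b c + msum f n c a.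

(** The inner triangle is oriented so that each of its edges meets its reverse in a neighbouring
    piece. *)
Lemma tsumS (R : realType) (f : Cplx R -> Cplx R) n (a b c : Cplx R) :
  tsum f n.+1 a b c = tsum f n a (mid a b) (mid c a)
    + tsum f n (mid a b) b (mid b c) + tsum f n (mid c a) (mid b c) c
    + tsum f n (mid b c) (mid c a) (mid a b).
Proof.
rewrite /tsum /= (msumN f n (mid c a) (mid a b)).
by rewrite (msumN f n (mid a b) (mid b c)) (msumN f n (mid b c) (mid c a)); ring.
Qed.

Lemma tsum_affine (R : realType) (p q : Cplx R) n (a b c : Cplx R) :
  tsum (fun z => p + q * z) n a b c = 0.
Proof. by rewrite /tsum !msumD !msum_cst !msumZ !msum_id; field. Qed.

Lemma tsumD (R : realType) (f g : Cplx R -> Cplx R) n (a b c : Cplx R) :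
  tsum (fun z => f z + g z) n a b c = tsum f n a b c + tsum g n a b c.
Proof. by rewrite /tsum !msumD; ring. Qed.

Lemma eventually_le4 (R : realType) (x y z t : nat -> Cplx R) (e1 e2 e3 e4 : R) :
  (exists n0 : nat, forall n, (n0 <= n)%N -> cabs (x n) <= e1) ->
  (exists n0 : nat, forall n, (n0 <= n)%N -> cabs (y n) <= e2) ->
  (exists n0 : nat, forall n, (n0 <= n)%N -> cabs (z n) <= e3) ->
  (exists n0 : nat, forall n, (n0 <= n)%N -> cabs (t n) <= e4) ->
  exists n0 : nat, forall n, (n0 <= n)%N ->
    cabs (x n + y n + z n + t n) <= e1 + e2 + e3 + e4.
Proof.
have step (a b : nat -> Cplx R) (ea eb : R) :
    (exists n0 : nat, forall n, (n0 <= n)%N -> cabs (a n) <= ea) ->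
    (exists n0 : nat, forall n, (n0 <= n)%N -> cabs (b n) <= eb) ->
    exists n0 : nat, forall n, (n0 <= n)%N -> cabs (a n + b n) <= ea + eb.
  by apply: eventually2 => n ha hb; exact: le_trans (cabsD _ _) (lerD ha hb).
by move=> h1 h2 h3 h4; apply/(step (fun n => x n + y n + z n))/h4/step/h3/step.
Qed.

Lemma eventually_succ (P : nat -> Prop) :
  (exists n0 : nat, forall n, (n0 <= n)%N -> P n.+1) ->
  exists n0 : nat, forall n, (n0 <= n)%N -> P n.
Proof. by move=> [n0 h]; exists n0.+1 => -[|n]//; exact: h. Qed.

(** The error is measured against the squared perimeter s^2: four pieces of perimeter s / 2
    contribute 4 (s / 2)^2 = s^2, so a failure passes to one of them. On a small triangle,
    subtracting the tangent leaves an integrand of size e s along a path of length s. *)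
Lemma goursat (R : realType) (u : Cplx R) t (f : Cplx R -> Cplx R) a b c :
  (forall z, halfplane u t z -> derivable f z 1) ->
  halfplane u t a -> halfplane u t b -> halfplane u t c ->
  vanishing (fun n => tsum f n a b c).
Proof.
move=> df Ha Hb Hc.
pose x (s : Cplx R * Cplx R * Cplx R) := s.1.1.
pose size (s : Cplx R * Cplx R * Cplx R) :=
  cabs (s.1.2 - s.1.1) + cabs (s.2 - s.1.2) + cabs (s.1.1 - s.2).
pose Q (s : Cplx R * Cplx R * Cplx R) :=
  [/\ halfplane u t s.1.1, halfplane u t s.1.2 & halfplane u t s.2].
have size0 s : 0 <= size s by rewrite !addr_ge0// cabs_ge0.
suff main (e : R) : 0 < e -> exists n0 : nat, forall n, (n0 <= n)%N ->
    cabs (tsum f n a b c) <= e * (size (a, b, c)) ^+ 2.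
  move=> e e0; have p : 0 < size (a, b, c) ^+ 2 + 1.
    by have := sqr_ge0 (size (a, b, c)); lra.
  have [n0 h] := main _ (divr_gt0 e0 p).
  exists n0 => n n0n; apply: le_trans (h _ n0n) _.
  by rewrite mulrAC ler_pdivrMr// ler_wpM2l ?ltW//; lra.
move=> e0.
pose P s := exists n0 : nat, forall n, (n0 <= n)%N ->
  cabs (tsum f n s.1.1 s.1.2 s.2) <= e * (size s) ^+ 2.
apply: (@bisection R _ x size Q P _ _ _ (a, b, c)) => //.
- move=> [[p q] r] [/= Hp Hq Hr] nP.
  have Hpq := halfplane_mid Hp Hq; have Hqr := halfplane_mid Hq Hr.
  have Hrp := halfplane_mid Hr Hp.
  pose s1 := (p, mid p q, mid r p); pose s2 := (mid p q, q, mid q r).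
  pose s3 := (mid r p, mid q r, r); pose s4 := (mid q r, mid r p, mid p q).
  have E1 : size s1 = size (p, q, r) / 2.
    rewrite /size/= midBl (_ : mid r p - mid p q = (r - q) / 2); last first.
      by rewrite /mid; field.
    by rewrite midBr !cabs_half; ring.
  have E2 : size s2 = size (p, q, r) / 2.
    rewrite /size/= midBr midBl (_ : mid p q - mid q r = (p - r) / 2).
      by rewrite !cabs_half; ring.
    by rewrite /mid; field.
  have E3 : size s3 = size (p, q, r) / 2.
    rewrite /size/= midBr midBl (_ : mid q r - mid r p = (q - p) / 2).
      by rewrite !cabs_half; ring.
    by rewrite /mid; field.
  have E4 : size s4 = size (p, q, r) / 2.
    rewrite /size/= (_ : mid r p - mid q r = (p - q) / 2).
      rewrite (_ : mid p q - mid r p = (q - r) / 2).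
        rewrite (_ : mid q r - mid p q = (r - p) / 2).
          by rewrite !cabs_half (cabsB p q) (cabsB q r) (cabsB r p); ring.
        by rewrite /mid; field.
      by rewrite /mid; field.
    by rewrite /mid; field.
  have Ex : [\/ ~ P s1, ~ P s2, ~ P s3 | ~ P s4].
    apply: contrapT => nEx; apply: nP; apply: eventually_succ.
    have P1 : P s1 by apply: contrapT => ?; apply: nEx; exact: Or41.
    have P2 : P s2 by apply: contrapT => ?; apply: nEx; exact: Or42.
    have P3 : P s3 by apply: contrapT => ?; apply: nEx; exact: Or43.
    have P4 : P s4 by apply: contrapT => ?; apply: nEx; exact: Or44.
    have [n0 h] := eventually_le4 P1 P2 P3 P4.
    exists n0 => n /h; rewrite E1 E2 E3 E4 tsumS/=.
    by move/le_trans; apply; rewrite le_eqVlt; apply/orP; left; apply/eqP; field.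
  have h0 := cabs_ge0 (q - p); have h1 := cabs_ge0 (r - q).
  have h2 := cabs_ge0 (p - r).
  case: Ex => nP'.
  + by exists s1; split => //; rewrite /x/= subrr cabs0.
  + by exists s2; split => //; rewrite /x/= midBl cabs_half /size/=; lra.
  + exists s3; split => //; rewrite /x/= midC midBl cabs_half /size/=.
    by rewrite cabsB; lra.
  + exists s4; split => //; rewrite /x/=.
    have -> : mid q r - p = ((q - p) + (r - p)) / 2 by rewrite /mid; field.
    rewrite cabs_half /size/=; have := cabsD (q - p) (r - p).
    by rewrite (cabsB r p); lra.
- move=> z hz; have Hz : halfplane u t z.
    by apply: halfplane_closed => d /hz[[[p q] r] [Hp _ _] ?]; exists p.
  have e3 : 0 < e / 3 by lra.
  have [d d0 h] := is_derive_cabs (derivableP (df _ Hz)) e3.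
  exists (d / 3); first lra.
  move=> [[p q] r] _; rewrite /x/= => hp hs; exists 0%N => n _ /=.
  set s := size _ in hp hs *; set D := 'D_1 f z in h.
  have -> : tsum f n p q r = tsum (fun y => f y - (f z + D * (y - z))) n p q r.
    rewrite -[RHS]addr0 -(tsum_affine (f z - D * z) D n p q r) -tsumD.
    by congr (tsum _ _ _ _ _); apply/funext => y; ring.
  have h0 := cabs_ge0 (q - p); have h1 := cabs_ge0 (r - q).
  have h2 := cabs_ge0 (p - r).
  have sE : s = cabs (q - p) + cabs (r - q) + cabs (p - r) by [].
  pose B := [set y | cabs (y - z) <= 3 * s].
  have Bp : B p by rewrite /B/= sE; move: hp; rewrite sE; lra.
  have Bq : B q.
    by rewrite /B/=; have := cabs_triangle p q z; move: hp; rewrite sE; lra.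
  have Br : B r.
    rewrite /B/=; have := cabs_triangle p r z; rewrite (cabsB r p).
    by move: hp; rewrite sE; lra.
  have hB y : B y -> cabs (f y - (f z + D * (y - z))) <= e * s.
    rewrite /B/= => hy; have /h : cabs (y - z) < d by lra.
    by rewrite opprD addrA; nra.
  have := cabs_msum_le n (@disc_mid _ _ _) Bp Bq hB.
  have := cabs_msum_le n (@disc_mid _ _ _) Bq Br hB.
  have := cabs_msum_le n (@disc_mid _ _ _) Br Bp hB.
  rewrite /tsum; set X := msum _ _ r p; set Y := msum _ _ q r; set Z := msum _ _ p q.
  move=> hX hY hZ.
  have := cabsD (Z + Y) X; have := cabsD Z Y.
  have -> : e * s ^+ 2 =
    e * s * cabs (q - p) + e * s * cabs (r - q) + e * s * cabs (p - r).
    by rewrite -!mulrDr -sE; ring.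
  lra.
Qed.

(* At the vertex [w] boundedness replaces differentiability: halving the
   triangle towards [w] only leaves triangles on which [goursat] applies. *)
Lemma goursat_vertex (R : realType) (u w : Cplx R) (f : Cplx R -> Cplx R)
    (r M : R) p q :
  (forall z, z != w -> derivable f z 1) ->
  0 < r -> 0 < M -> (forall z, cabs (z - w) < r -> cabs (f z) <= M) ->
  complex.Re (u * w) < complex.Re (u * p) ->
  complex.Re (u * w) < complex.Re (u * q) ->
  vanishing (fun n => tsum f n w p q).
Proof.
move=> df r0 M0 fM wp wq e e0.
(* If two vertices are within d of w, the perimeter is at most 4 d and the sums are at most M (4 d)
   <= e / 2; the other half of e pays for the triangles away from w. *)
pose d := Num.min (r / 2) (e / (8 * M)).
have d0 : 0 < d by rewrite lt_min !divr_gt0// ?mulr_gt0.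
have dr : d < r by rewrite gt_min; apply/orP; left; lra.
have dM : M * (4 * d) <= e / 2.
  have : d <= e / (8 * M) by rewrite ge_min lexx orbT.
  by rewrite ler_pdivlMr ?mulr_gt0//; lra.
(* Each halving towards w produces one triangle at w and three away from it. Only the allowance e'
   is divided among them; the term M (4 d) is passed on to the triangle at w alone. *)
suff main m : forall (e' : R) p' q', 0 < e' ->
    complex.Re (u * w) < complex.Re (u * p') ->
    complex.Re (u * w) < complex.Re (u * q') ->
    cabs (p' - w) <= 2 ^+ m * d -> cabs (q' - w) <= 2 ^+ m * d ->
    exists n0 : nat, forall n, (n0 <= n)%N ->
      cabs (tsum f n w p' q') <= M * (4 * d) + e'.
  have [m hm] : exists m : nat, (cabs (p - w) + cabs (q - w)) / d <= 2 ^+ m.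
    have := archi_boundP (divr_ge0 (addr_ge0 (cabs_ge0 (p - w))
      (cabs_ge0 (q - w))) (ltW d0)).
    move: (Num.bound _) => m hm; exists m; apply/ltW/(lt_le_trans hm).
    by rewrite -natrX ler_nat ltnW// ltn_expl.
  move: hm; rewrite ler_pdivrMr// => hm.
  have := cabs_ge0 (p - w); have := cabs_ge0 (q - w) => ? ?.
  have [||n0 h] := main m (e / 2) p q ltac:(lra) wp wq; [lra|lra|].
  by exists n0 => n /h; lra.
elim: m => [|m IH] e' p' q' e'0 wp' wq' hp hq.
  move: hp hq; rewrite expr0 mul1r => hp hq; exists 0%N => n _.
  pose B := [set y | cabs (y - w) <= d].
  have Bw : B w by rewrite /B/= subrr cabs0 ltW.
  have fB y : B y -> cabs (f y) <= M by rewrite /B/= => hy; apply: fM; lra.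
  have mB : midclosed B by exact: disc_mid.
  have := cabs_msum_le n mB Bw hp fB; have := cabs_msum_le n mB hp hq fB.
  have := cabs_msum_le n mB hq Bw fB; rewrite /tsum.
  set X := msum _ _ q' w; set Y := msum _ _ p' q'; set Z := msum _ _ w p'.
  move=> hX hY hZ.
  have := cabsD (Z + Y) X; have := cabsD Z Y.
  have := cabs_triangle w q' p'; move: hX; rewrite (cabsB w) (cabsB w p').
  have := ler_wpM2l (ltW M0) hp; have := ler_wpM2l (ltW M0) hq.
  move=> ? ? ? /(ler_wpM2l (ltW M0)); lra.
(* Halfway between w and the nearer vertex in the direction u: this level excludes w but keeps the
   midpoints of the two edges at w. *)
pose t := (Num.min (complex.Re (u * p')) (complex.Re (u * q')) +
  complex.Re (u * w)) / 2.
pose l := Num.min (complex.Re (u * p')) (complex.Re (u * q')).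
have lp : l <= complex.Re (u * p') by rewrite ge_min lexx.
have lq : l <= complex.Re (u * q') by rewrite ge_min lexx orbT.
have lw : complex.Re (u * w) < l by rewrite lt_min wp'.
have tE : t = (l + complex.Re (u * w)) / 2 by [].
have dft z : halfplane u t z -> derivable f z 1.
  move=> hz; apply: df; apply: contraPneq hz => ->.
  by rewrite /halfplane/=; apply/negP; rewrite -ltNge tE; lra.
have Hp : halfplane u t p' by rewrite /halfplane/= tE; lra.
have Hq : halfplane u t q' by rewrite /halfplane/= tE; lra.
have Hwp : halfplane u t (mid w p') by rewrite /halfplane/= Re_mid tE; lra.
have Hqw : halfplane u t (mid q' w) by rewrite /halfplane/= Re_mid tE; lra.
have Hpq : halfplane u t (mid p' q') by rewrite /halfplane/= Re_mid tE; lra.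
have e4 : 0 < e' / 4 by lra.
have T1 : exists n0 : nat, forall n, (n0 <= n)%N ->
    cabs (tsum f n w (mid w p') (mid q' w)) <= M * (4 * d) + e' / 4.
  apply: IH => //.
  - by rewrite Re_mid; lra.
  - by rewrite Re_mid; lra.
  - by rewrite midBl cabs_half; move: hp; rewrite exprS; lra.
  - by rewrite midC midBl cabs_half; move: hq; rewrite exprS; lra.
have [n0 h] := eventually_le4 T1 (goursat dft Hwp Hp Hpq e4)
  (goursat dft Hqw Hpq Hq e4) (goursat dft Hpq Hqw Hwp e4).
apply: eventually_succ; exists n0 => n /h; rewrite tsumS; lra.
Qed.

(** * Sums over the boundary of a square *)

Definition imag (R : realType) : Cplx R := Complex 0 1.

(** Counterclockwise from 4 - 4i. Multiplication by i^-s carries side s to the right-hand side Re z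
    = 4, so all four sides are treated alike. *)
Definition corner (R : realType) (s : nat) : Cplx R :=
  imag R ^+ s * (4 - 4 * imag R).

Definition side (R : realType) (s : nat) : set (Cplx R) :=
  [set z | exists2 x : R, 0 <= x <= 1 &
     z = corner R s + RtoC x * (corner R s.+1 - corner R s)].

Arguments side R s : clear implicits.

Definition sqsum (R : realType) (f : Cplx R -> Cplx R) (n : nat) : Cplx R :=
  \sum_(s < 4) msum f n (corner R s) (corner R s.+1).

Lemma imag2 (R : realType) : imag R ^+ 2 = -1.
Proof. exact: sqr_i. Qed.

Lemma imag_neq0 (R : realType) : imag R != 0.
Proof. by rewrite eq_complex/= oner_eq0 andbF. Qed.

Lemma cabs_imag (R : realType) : cabs (imag R) = 1.
Proof. by rewrite /= expr0n/= add0r expr1n sqrtr1. Qed.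

Lemma cornerS (R : realType) s :
  corner R s.+1 = imag R ^+ s * (4 + 4 * imag R).
Proof.
rewrite /corner exprSr -mulrA; congr (_ * _).
have -> : imag R * (4 - 4 * imag R) = 4 * imag R - 4 * imag R ^+ 2 by ring.
by rewrite imag2; ring.
Qed.

Lemma corner4 (R : realType) : corner R 4 = corner R 0.
Proof.
rewrite /corner (_ : imag R ^+ 4 = (imag R ^+ 2) ^+ 2); last by rewrite -exprM.
by rewrite imag2 sqrrN !expr1n.
Qed.

Lemma side_mid (R : realType) s : midclosed (side R s).
Proof.
move=> a b [x /andP[x0 x1] ->] [y /andP[y0 y1] ->].
exists ((x + y) / 2); first by apply/andP; split; lra.
have -> : RtoC ((x + y) / 2) = (RtoC x + RtoC y) / 2 :> Cplx R.
  by rewrite /RtoC rmorphM fmorphV rmorphD rmorph_nat.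
by rewrite /mid; field.
Qed.

Lemma side_corner (R : realType) s : side R s (corner R s).
Proof. by exists 0; rewrite ?lexx ?ler01// /RtoC rmorph0 mul0r addr0. Qed.

Lemma side_cornerS (R : realType) s : side R s (corner R s.+1).
Proof. by exists 1; rewrite ?lexx ?ler01// /RtoC rmorph1 mul1r addrC subrK. Qed.

Lemma Re_corner (R : realType) s :
  complex.Re (imag R ^- s * corner R s) = 4 /\
  complex.Re (imag R ^- s * corner R s.+1) = 4.
Proof.
rewrite cornerS /corner !mulKf ?expf_neq0 ?imag_neq0//.
have E : (4 : Cplx R) = RtoC 4 by rewrite /RtoC rmorph_nat.
by rewrite E /=; split; ring.
Qed.

Lemma side_halfplane (R : realType) s z :
  side R s z -> halfplane (imag R ^- s) 4 z.
Proof.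
have [h1 h2] := Re_corner R s.
move=> [x _ ->]; rewrite /halfplane/=.
have -> : imag R ^- s * (corner R s + RtoC x * (corner R s.+1 - corner R s)) =
  imag R ^- s * corner R s +
  RtoC x * (imag R ^- s * corner R s.+1 - imag R ^- s * corner R s) by ring.
rewrite raddfD/= h1.
move: h1 h2; case: (_ * _) => [a b]; case: (_ * _) => [a' b'] /= -> ->.
by lra.
Qed.

Lemma cabs_imagX (R : realType) s : cabs (imag R ^- s) = 1.
Proof. by rewrite cabsV cabsX cabs_imag expr1n invr1. Qed.

Lemma Re_imagX_le (R : realType) s (w : Cplx R) :
  complex.Re (imag R ^- s * w) <= cabs w.
Proof.
rewrite -[leRHS]mul1r -(cabs_imagX R s) -cabsM.
exact: le_trans (ler_norm _) (cabs_Re _).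
Qed.

Lemma halfplane_far (R : realType) s (z w : Cplx R) :
  halfplane (imag R ^- s) 4 z -> cabs w <= 2 -> 2 <= cabs (z - w).
Proof.
rewrite /halfplane/= => hz hw; have := Re_imagX_le s z.
by have := cabs_triangle w z 0; rewrite !subr0; lra.
Qed.

Lemma halfplane_cabs (R : realType) s (z : Cplx R) :
  halfplane (imag R ^- s) 4 z -> 4 <= cabs z.
Proof. by rewrite /halfplane/=; have := Re_imagX_le s z; lra. Qed.

Lemma halfplane_neq0 (R : realType) s (z : Cplx R) :
  halfplane (imag R ^- s) 4 z -> z != 0.
Proof. by rewrite -cabs_gt0 => /halfplane_cabs; lra. Qed.

Lemma cabs_side (R : realType) s : cabs (corner R s.+1 - corner R s) = 8.
Proof.
rewrite cornerS /corner -mulrBr cabsM cabsX cabs_imag expr1n mul1r.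
have -> : 4 + 4 * imag R - (4 - 4 * imag R) = 8 * imag R by ring.
by rewrite cabsM cabs_imag cabs_nat mulr1.
Qed.

Lemma eq_sqsum (R : realType) (f g : Cplx R -> Cplx R) n :
  (forall s z, side R s z -> f z = g z) -> sqsum f n = sqsum g n.
Proof.
move=> fg; apply: eq_bigr => s _.
apply: (@eq_msum _ (side R s)); [exact: side_mid|exact: side_corner|
  exact: side_cornerS|exact: fg].
Qed.

Lemma sqsumD (R : realType) (f g : Cplx R -> Cplx R) n :
  sqsum (fun z => f z + g z) n = sqsum f n + sqsum g n.
Proof. by rewrite -big_split; apply: eq_bigr => s _; exact: msumD. Qed.

Lemma sqsumZ (R : realType) k (f : Cplx R -> Cplx R) n :
  sqsum (fun z => k * f z) n = k * sqsum f n.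
Proof. by rewrite mulr_sumr; apply: eq_bigr => s _; exact: msumZ. Qed.

Lemma sqsum_sum (R : realType) (f : nat -> Cplx R -> Cplx R) m n :
  sqsum (fun z => \sum_(k < m) f k z) n = \sum_(k < m) sqsum (f k) n.
Proof.
elim: m => [|m IH].
  rewrite big_ord0 (@eq_sqsum _ _ (fun z => 0 * 0)) ?sqsumZ ?mul0r// => s z _.
  by rewrite big_ord0.
rewrite big_ord_recr/= -IH -sqsumD; apply: eq_sqsum => s z _.
by rewrite big_ord_recr.
Qed.

Lemma cabs_sqsum_le (R : realType) (f : Cplx R -> Cplx R) (k : R) n :
  (forall s z, (s < 4)%N -> side R s z -> cabs (f z) <= k) ->
  cabs (sqsum f n) <= 32 * k.
Proof.
move=> fk; apply: le_trans (cabs_sum _ _ _) _.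
apply: (@le_trans _ _ (\sum_(s < 4) (k * 8))).
  apply: ler_sum => s _; rewrite -(cabs_side R s).
  apply: (@cabs_msum_le _ (side R s)); [exact: side_mid|exact: side_corner|
    exact: side_cornerS|by move=> z; exact: fk].
by rewrite sumr_const card_ord -mulr_natr; lra.
Qed.

(** Each side lies in its own half-plane, which misses 0; so a pole at 0 is allowed although the
    square surrounds it. *)
Lemma sqsum_cvg (R : realType) (f : Cplx R -> Cplx R) :
  (forall z : Cplx R, z != 0 -> {for z, continuous f}) ->
  exists l : Cplx R, vanishing (fun n => sqsum f n - l).
Proof.
move=> cf.
have side_cvg s : exists l : Cplx R,
    vanishing (fun n => msum f n (corner R s) (corner R s.+1) - l).
  apply: (@msum_cvg _ (imag R ^- s) 4).
  - by move=> z /halfplane_neq0; exact: cf.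
  - by apply: side_halfplane; exact: side_corner.
  - by apply: side_halfplane; exact: side_cornerS.
rewrite /sqsum; elim: 4%N => [|m [l hl]].
  by exists 0 => e e0; exists 0%N => n _; rewrite big_ord0 subrr cabs0 ltW.
have [l' hl'] := side_cvg m.
exists (l + l') => e e0; have e2 : 0 < e / 2 by lra.
apply: eventually2 (hl _ e2) (hl' _ e2) => n h1 h2.
rewrite big_ord_recr/= opprD addrACA; apply: le_trans (cabsD _ _) _; lra.
Qed.

Lemma vanishing_sum (R : realType) m (f : nat -> nat -> Cplx R) :
  (forall s, (s < m)%N -> vanishing (f s)) ->
  vanishing (fun n => \sum_(s < m) f s n).
Proof.
elim: m => [|m IH] fs e e0.
  by exists 0%N => n _; rewrite big_ord0 cabs0 ltW.
have e2 : 0 < e / 2 by lra.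
apply: eventually2 (IH _ _ e2) (fs m _ _ e2) => // [n h1 h2|s sm].
  by rewrite big_ord_recr/=; apply: le_trans (cabsD _ _) _; lra.
exact: fs (leqW sm).
Qed.

(** The increments of F telescope around the closed contour. This disposes of every power z^-(k+2),
    leaving only z^-1. *)
Lemma sqsum_primitive (R : realType) (F f : Cplx R -> Cplx R) :
  (forall z : Cplx R, z != 0 -> {for z, continuous f}) ->
  (forall z : Cplx R, z != 0 -> is_derive z 1 F (f z)) ->
  vanishing (sqsum f).
Proof.
move=> cf dF e e0.
pose g s n := msum f n (corner R s) (corner R s.+1) -
  (F (corner R s.+1) - F (corner R s)).
have [|n0 h] := @vanishing_sum R 4 g _ e e0.
  move=> s _ e' e'0; apply: (@msum_primitive _ (imag R ^- s) 4 F) => //.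
  - by move=> z /halfplane_neq0; exact: cf.
  - by move=> z /halfplane_neq0; exact: dF.
  - by apply: side_halfplane; exact: side_corner.
  - by apply: side_halfplane; exact: side_cornerS.
have tele : \sum_(s < 4) (F (corner R s.+1) - F (corner R s)) = 0.
  by rewrite !big_ord_recl big_ord0/= /bump/= corner4; ring.
by exists n0 => n /h; rewrite /g sumrB tele subr0.
Qed.

(** A lower bound in place of the value 2 pi i. Since dz / z is invariant under rotation, each side
    reduces to z = 4 + i y with |y| <= 4, where Im (dz / z) = 4 / (16 + y^2) dy >= dy / 8; the
    length 8 gives at least 1 per side. *)
Lemma sqsum_inv_ge (R : realType) n :
  4 <= complex.Im (sqsum (fun z : Cplx R => z^-1) n).
Proof.
have main s : forall (a b : R), -4 <= a -> a <= b -> b <= 4 ->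
    (b - a) / 8 <= complex.Im (msum (fun z => z^-1) n
      (imag R ^+ s * (Complex 4 a)) (imag R ^+ s * (Complex 4 b))).
  elim: n => [|n IH] a b a4 ab b4.
    have -> : msum (fun z => z^-1) 0 (imag R ^+ s * Complex 4 a)
        (imag R ^+ s * Complex 4 b) =
        Complex 0 (b - a) * (Complex 4 ((a + b) / 2))^-1.
      have cancel (v A B : Cplx R) : v != 0 ->
          (v * B - v * A) * (mid (v * A) (v * B))^-1 = (B - A) * (mid A B)^-1.
        move=> v0; rewrite /mid -mulrBr -mulrDr -(mulrA v) invfM mulrACA.
        by rewrite mulfV// mul1r.
      rewrite /= cancel ?expf_neq0 ?imag_neq0// /mid.
      have -> : (Complex 4 b - Complex 4 a : Cplx R) = Complex 0 (b - a).
        by apply/eqP; rewrite eq_complex/= subrr !eqxx.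
      congr (_ * _^-1).
      have -> : (2 : Cplx R)^-1 = RtoC 2^-1 by rewrite /RtoC fmorphV rmorph_nat.
      by apply/eqP; rewrite eq_complex/=; apply/andP; split; apply/eqP; field.
    rewrite /= mul0r add0r; set q := 4 ^+ 2 + _.
    have q0 : 0 < q by rewrite /q; nra.
    have q32 : q <= 32 by rewrite /q; nra.
    rewrite ler_wpM2l ?subr_ge0// ler_pdivlMr//; lra.
  rewrite /= (_ : mid _ _ = imag R ^+ s * Complex 4 ((a + b) / 2)).
    by rewrite raddfD/=; have := IH a ((a + b) / 2); have := IH ((a + b) / 2) b; lra.
  rewrite /mid -mulrDr -mulrA; congr (_ * _).
  have -> : (2 : Cplx R)^-1 = RtoC 2^-1 by rewrite /RtoC fmorphV rmorph_nat.
  by apply/eqP; rewrite eq_complex/=; apply/andP; split; apply/eqP; field.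
have {}main s : 1 <= complex.Im (msum (fun z => z^-1) n (corner R s) (corner R s.+1)).
  rewrite cornerS /corner.
  have -> : 4 - 4 * imag R = Complex 4 (-4).
    have -> : (4 : Cplx R) = RtoC 4 by rewrite /RtoC rmorph_nat.
    by apply/eqP; rewrite eq_complex/=; apply/andP; split; apply/eqP; ring.
  have -> : 4 + 4 * imag R = Complex 4 4.
    have -> : (4 : Cplx R) = RtoC 4 by rewrite /RtoC rmorph_nat.
    by apply/eqP; rewrite eq_complex/=; apply/andP; split; apply/eqP; ring.
  by apply: le_trans (main s _ _ _ _ _); lra.
rewrite /sqsum raddf_sum/=; have -> : (4 : R) = \sum_(s < 4) 1.
  by rewrite sumr_const card_ord.
by apply: ler_sum => s _; exact: main.
Qed.

Lemma vanishingD (R : realType) (x y : nat -> Cplx R) :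
  vanishing x -> vanishing y -> vanishing (fun n => x n + y n).
Proof.
move=> hx hy e e0; have e2 : 0 < e / 2 by lra.
by apply: eventually2 (hx _ e2) (hy _ e2) => n ? ?; apply: le_trans (cabsD _ _) _; lra.
Qed.

Lemma vanishingZ (R : realType) k (x : nat -> Cplx R) :
  vanishing x -> vanishing (fun n => k * x n).
Proof.
move=> hx e e0; have k1 : 0 < cabs k + 1 by have := cabs_ge0 k; lra.
have [n0 h] := hx _ (divr_gt0 e0 k1); exists n0 => n /h.
rewrite cabsM ler_pdivlMr//; have := cabs_ge0 (x n); nra.
Qed.

Lemma vanishing_bound (R : realType) (x : nat -> Cplx R) (c : Cplx R) (M : R) :
  vanishing x -> (forall n, cabs (c - x n) <= M) -> cabs c <= M.
Proof.
move=> hx hM; apply/ler_addgt0Pr => e /hx[n0 /(_ n0 (leqnn _)) h].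
by have := hM n0; have := cabs_triangle (x n0) c 0; rewrite !subr0; lra.
Qed.

(** * Cauchy's formula and Taylor coefficients *)

Lemma cauchy_square (R : realType) (G : Cplx R -> Cplx R) (w : Cplx R) :
  entire G -> cabs w <= 2 ->
  vanishing (sqsum (fun z => (G z - G w) * (z - w)^-1)).
Proof.
(* At [z = w] the quotient is the junk value [0 / 0 = 0], which is harmless since
   [goursat_vertex] only asks for a bound near [w]. *)
move=> dG w2; set h := fun z => _.
have dh (z : Cplx R) : z != w -> derivable h z 1.
  move=> zw.
  have -> : h = (G - cst (G w)) * (fun z => ((id - cst w) z)^-1) by apply/funext.
  apply: derivableM; first by apply: derivableB; [exact: dG|exact: derivable_cst].
  apply: derivableV; first by rewrite /= subr_eq0.
  by apply: derivableB; [exact: derivable_id|exact: derivable_cst].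
have [d d0 hd] := is_derive_cabs (derivableP (dG w)) ltr01.
set D := 'D_1 G w in hd.
have hM z : cabs (z - w) < d -> cabs (h z) <= cabs D + 1.
  move=> /hd; have [->|zw] := eqVneq z w.
    by rewrite /h !subrr mul0r cabs0 => _; have := cabs_ge0 D; lra.
  have zw0 : 0 < cabs (z - w) by rewrite cabs_gt0 subr_eq0.
  rewrite cabsM cabsV ler_pdivrMr// => hz.
  by have := cabsD (G z - G w - D * (z - w)) (D * (z - w));
    rewrite subrK cabsM; nra.
have M0 : 0 < cabs D + 1 by have := cabs_ge0 D; lra.
(* Fan of four triangles with apex w; the edges through w cancel in pairs. *)
have -> : sqsum h = fun n => \sum_(s < 4) tsum h n w (corner R s) (corner R s.+1).
  apply/funext => n.
  rewrite /sqsum !big_ord_recl !big_ord0/= /bump/= corner4 /tsum.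
  rewrite (msumN h n (corner R 0) w) (msumN h n (corner R 1) w).
  by rewrite (msumN h n (corner R 2) w) (msumN h n (corner R 3) w); ring.
apply: (@vanishing_sum R 4 (fun s n => tsum h n w (corner R s) (corner R s.+1))).
move=> s _.
(* Re (i^-s w) <= 2 < 4 separates the apex from side s, as [goursat_vertex] requires. *)
have [h1 h2] := Re_corner R s; have hw := Re_imagX_le s w.
apply: (@goursat_vertex _ (imag R ^- s) w h d _ _ _ dh d0 M0 hM); lra.
Qed.

Lemma is_derive_invX (R : realType) (z : Cplx R) n : z != 0 ->
  is_derive z 1 (fun x : Cplx R => - n.+1%:R^-1 * x^-1 ^+ n.+1) (z^-1 ^+ n.+2).
Proof.
move=> z0.
have dV : is_derive z 1 (fun x : Cplx R => x^-1) (- z ^- 2).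
  split; first by apply: (@derivableV R[i] (Cplx R) id) => //; exact: derivable_id.
  rewrite (@deriveV R[i] (Cplx R) id)//.
  by rewrite derive_id /GRing.scale/= mulr1.
have -> : (fun x : Cplx R => - n.+1%:R^-1 * x^-1 ^+ n.+1) =
    (- n.+1%:R^-1) \*: ((fun x : Cplx R => x^-1) ^+ n.+1).
  by apply/funext => x; rewrite /= fctE.
have n0 : n.+1%:R != 0 :> Cplx R by rewrite pnatr_eq0.
suff -> : z^-1 ^+ n.+2 =
    - n.+1%:R^-1 *: ((n.+1%:R * z^-1 ^+ n.+1.-1) *: (- z ^- 2)) :> Cplx R.
  exact: is_deriveZ.
rewrite /GRing.scale/= -exprVn.
have -> : z^-1 ^+ n.+2 = z^-1 ^+ n * z^-1 ^+ 2 by rewrite -exprD addn2.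
by set q := z^-1 ^+ n; set q' := z^-1 ^+ 2; field.
Qed.

Lemma geometric_remainder (R : realType) (z w : Cplx R) m :
  z != 0 -> z - w != 0 ->
  (z - w)^-1 = \sum_(k < m) w ^+ k * z^-1 ^+ k.+1 + (w / z) ^+ m / (z - w).
Proof.
move=> z0 zw; elim: m => [|m IH]; first by rewrite big_ord0 add0r mul1r.
rewrite big_ord_recr/= {1}IH -addrA; congr (_ + _).
rewrite exprMn exprS (exprS (w / z)) exprMn; set x := z^-1 ^+ m; set y := w ^+ m.
by field; rewrite z0 zw.
Qed.

Lemma sides_bounded (R : realType) (G : Cplx R -> Cplx R) :
  entire G -> exists2 M : R, 0 < M &
    forall s z, (s < 4)%N -> side R s z -> cabs (G z) <= M.
Proof.
move=> dG; elim: 4%N => [|m [M M0 hM]]; first by exists 1.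
have inH z : halfplane (0 : Cplx R) 0 z by rewrite /halfplane/= mul0r.
have cG (c : Cplx R) : halfplane 0 0 c -> {for c, continuous G}.
  by move=> _; apply: differentiable_continuous; apply/derivable1_diffP.
have [M' M'0 hM'] := segment_bounded cG (inH (corner R m)) (inH (corner R m.+1)).
exists (M + M'); first lra.
move=> s z; rewrite ltnS leq_eqVlt => /orP[/eqP ->|sm].
  by move=> [x x01 ->]; have := hM' _ x01; lra.
by move=> /(hM _ _ sm); lra.
Qed.

(** Coefficients are quotients B_k / A of the limits for G z / z^(k+1) and for 1 / z. The constant C
    may depend on w, because the remainder involves G w; later it is only used at finitely many
    points with N fixed. *)
Lemma taylor (R : realType) (G : Cplx R -> Cplx R) : entire G ->
  exists a : nat -> Cplx R, exists2 M : R, 0 < M &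
    (forall k, cabs (a k) <= M / 4 ^+ k) /\
    forall w : Cplx R, cabs w <= 2 -> exists2 C : R, 0 <= C &
      forall m, cabs (G w - \sum_(k < m.+1) a k * w ^+ k) <= C / 2 ^+ m.
Proof.
move=> dG; have [M M0 hM] := sides_bounded dG.
pose E k (z : Cplx R) := z^-1 ^+ k.+1.
have dE k (z : Cplx R) : z != 0 -> derivable (E k) z 1.
  move=> z0; rewrite (_ : E k = (fun x : Cplx R => x^-1) ^+ k.+1); last first.
    by apply/funext => x; rewrite exprfctE.
  apply: derivableX; apply: (@derivableV R[i] (Cplx R) id) => //; exact: derivable_id.
have cont (f : Cplx R -> Cplx R) (z : Cplx R) :
    derivable f z 1 -> {for z, continuous f}.
  by move=> df; apply: differentiable_continuous; apply/derivable1_diffP.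
have lim_sq (f : Cplx R -> Cplx R) : (forall z : Cplx R, z != 0 -> derivable f z 1) ->
    exists l, vanishing (fun n => sqsum f n - l).
  by move=> df; apply: sqsum_cvg => z z0; apply: cont; exact: df.
have [A hA] := lim_sq (E 0%N) (@dE 0%N).
have A4 : 4 <= cabs A.
  apply/ler_addgt0Pr => e /hA[n0 /(_ n0 (leqnn _)) hn].
  have := cabs_triangle A (sqsum (E 0%N) n0) 0; rewrite !subr0.
  have := sqsum_inv_ge R n0; rewrite -[sqsum _ n0]/(sqsum (E 0%N) n0).
  have := le_trans (ler_norm _) (cabs_Im (sqsum (E 0%N) n0)); lra.
have A0 : A != 0 by rewrite -cabs_gt0; lra.
have [|B hB] := @choice nat (Cplx R)
    (fun k l => vanishing (fun n => sqsum (fun z => G z * E k z) n - l)).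
  by move=> k; apply: lim_sq => z z0; apply: derivableM; [exact: dG|exact: dE].
have E_side k s z : side R s z -> cabs (E k z) <= 4^-1 ^+ k.+1.
  move=> /side_halfplane/halfplane_cabs z4; rewrite cabsX cabsV.
  by rewrite lerXn2r ?nnegrE ?invr_ge0 ?cabs_ge0// lef_pV2 ?posrE//; lra.
(* Perimeter 32, |z| >= 4 on the sides and |A| >= 4 give 32 M / 4^(k+1) / 4 = 2 M / 4^k. *)
exists (fun k => B k / A), (2 * M); [lra|split].
  move=> k; rewrite cabsM cabsV ler_pdivrMr; last lra.
  have Bk : cabs (B k) <= 32 * (M * 4^-1 ^+ k.+1).
    apply: (vanishing_bound (x := fun n => -1 * (sqsum (fun z => G z * E k z) n - B k))).
      by apply: vanishingZ; exact: hB.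
    move=> n; rewrite mulN1r opprK addrC subrK; apply: cabs_sqsum_le => s z s4 sz.
    by rewrite cabsM ler_pM ?cabs_ge0 ?(hM _ _ s4 sz) ?(E_side _ _ _ sz).
  move: Bk; rewrite exprSr exprVn; have : 0 < (4 ^+ k : R)^-1 by rewrite invr_gt0 exprn_gt0.
  set q := _^-1 => q0.
  by have := ler_wpM2l (ltW (mulr_gt0 M0 q0)) A4; lra.
move=> w w2; pose Gw := G w.
have h := cauchy_square dG w2; rewrite -/Gw in h.
exists (2 * (M + cabs Gw)); first by have := cabs_ge0 Gw; lra.
move=> m.
pose rem z := (G z - Gw) * ((w / z) ^+ m.+1 / (z - w)).
pose term k z := w ^+ k * (G z * E k z + - Gw * E k z).
(* Distance of the level-n sums from their limits; the sums of z^-(k+1) tend to A for k = 0 and to 0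
   otherwise. *)
pose err k n := w ^+ k * ((sqsum (fun z => G z * E k z) n - B k) +
   - Gw * (sqsum (E k) n - (k == 0)%N%:R * A)).
have verr : vanishing (fun n => \sum_(k < m.+1) err k n).
  apply: (@vanishing_sum R m.+1 err) => k _; apply: vanishingZ; apply: vanishingD; first exact: hB.
  apply: vanishingZ; case: k => [|k]; first by rewrite mul1r.
  rewrite mul0r => e e0; have [||n0 hn] := @sqsum_primitive R
    (fun x => - k.+1%:R^-1 * x^-1 ^+ k.+1) (E k.+1) _ _ e e0.
  - by move=> z z0; apply: cont; exact: dE.
  - by move=> z z0; exact: is_derive_invX.
  - by exists n0 => n; rewrite subr0; exact: hn.
have sqE n : sqsum (fun z => (G z - Gw) / (z - w)) n =
    \sum_(k < m.+1) (w ^+ k * (sqsum (fun z => G z * E k z) n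
      - Gw * sqsum (E k) n)) + sqsum rem n.
  have -> : sqsum (fun z => (G z - Gw) / (z - w)) n =
      sqsum (fun z => \sum_(k < m.+1) term k z + rem z) n.
    apply: eq_sqsum => s z /side_halfplane hz; have z0 := halfplane_neq0 hz.
    have zw : z - w != 0.
      by rewrite -cabs_gt0; have := halfplane_far hz w2; lra.
    rewrite (geometric_remainder m.+1 z0 zw) mulrDr; congr (_ + _).
    by rewrite mulr_sumr; apply: eq_bigr => k _; rewrite /term /E; ring.
  rewrite sqsumD (sqsum_sum term); congr (_ + _).
  by apply: eq_bigr => k _; rewrite sqsumZ sqsumD sqsumZ mulNr.
(* On the sides |w / z| <= 2 / 4 and |z - w| >= 2. *)
have remE n : cabs (sqsum rem n) <= 32 * ((M + cabs Gw) * (2^-1 ^+ m.+1 / 2)).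
  apply: cabs_sqsum_le => s z s4 sz; have hz := side_halfplane sz.
  rewrite /rem cabsM; apply: ler_pM; rewrite ?cabs_ge0//.
    apply: le_trans (cabsD _ _) _; rewrite cabsN.
    by have := hM _ _ s4 sz; lra.
  have z4 := halfplane_cabs hz.
  rewrite cabsM cabsX cabsM !cabsV; apply: ler_pM.
  - by rewrite exprn_ge0// divr_ge0 ?cabs_ge0.
  - by rewrite invr_ge0 cabs_ge0.
  - rewrite lerXn2r ?nnegrE ?divr_ge0 ?cabs_ge0 ?invr_ge0//.
    by rewrite ler_pdivrMr; lra.
  - have := halfplane_far hz w2 => zw.
    by rewrite lef_pV2 ?posrE//; lra.
have main : cabs (\sum_(k < m.+1) w ^+ k * B k - Gw * A) <=
    32 * ((M + cabs Gw) * (2^-1 ^+ m.+1 / 2)).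
  apply: (vanishing_bound (x := fun n => sqsum (fun z => (G z - Gw) / (z - w)) n
    + -1 * \sum_(k < m.+1) err k n)).
    by apply: vanishingD => //; exact: vanishingZ.
  move=> n; rewrite -cabsN; have := remE n.
  suff -> : sqsum rem n = - (\sum_(k < m.+1) w ^+ k * B k - Gw * A -
     (sqsum (fun z => (G z - Gw) / (z - w)) n + -1 * (\sum_(k < m.+1) err k n))) by [].
  have GwA : Gw * A = \sum_(k < m.+1) w ^+ k * (Gw * ((k == 0 :> nat)%:R * A)).
    rewrite big_ord_recl/= big1 ?addr0 ?expr0 ?mul1r// => k _.
    by rewrite mul0r !mulr0.
  have errE : \sum_(k < m.+1) err k n =
      \sum_(k < m.+1) (w ^+ k * (sqsum (fun z => G z * E k z) n
        - Gw * sqsum (E k) n)) - \sum_(k < m.+1) w ^+ k * B k + Gw * A.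
    rewrite GwA -sumrB -big_split/=; apply: eq_bigr => k _.
    by rewrite /err; ring.
  by rewrite errE sqE; ring.
have -> : G w - \sum_(k < m.+1) B k / A * w ^+ k =
    - (\sum_(k < m.+1) w ^+ k * B k - Gw * A) / A.
  rewrite opprB mulrBl mulfK// mulr_suml; congr (_ - _).
  by apply: eq_bigr => k _; rewrite mulrC mulrA.
rewrite cabsM cabsN cabsV ler_pdivrMr; last lra.
apply: le_trans main _; rewrite exprS exprVn.
have : 0 < (2 ^+ m : R)^-1 by rewrite invr_gt0 exprn_gt0.
set q := _^-1 => q0; have := cabs_ge0 Gw => Gw0.
have : 0 <= (M + cabs Gw) * q by rewrite mulr_ge0//; lra.
nra.
Qed.

(** * Bernstein moments of entire functions *)

(** [PN] with the sampled values left free: the moment recursion lowers N at fixed node spacing,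
    whereas in [PN] the spacing is written through N. *)
Definition bern (R : realType) (N : nat) (F : nat -> Cplx R) (z : Cplx R) :
    Cplx R :=
  \sum_(0 <= nu < N.+1) 'C(N, nu)%:R * z ^+ nu * (1 - z) ^+ (N - nu) * F nu.

Lemma bernD (R : realType) N (F H : nat -> Cplx R) z :
  bern N (fun nu => F nu + H nu) z = bern N F z + bern N H z.
Proof. by rewrite /bern -big_split; apply: eq_bigr => nu _; exact: mulrDr. Qed.

Lemma bernZ (R : realType) N k (F : nat -> Cplx R) z :
  bern N (fun nu => k * F nu) z = k * bern N F z.
Proof. by rewrite /bern mulr_sumr; apply: eq_bigr => nu _; ring. Qed.

Lemma bern_sum (R : realType) N m (F : nat -> nat -> Cplx R) z :
  bern N (fun nu => \sum_(k < m) F k nu) z = \sum_(k < m) bern N (F k) z.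
Proof.
by rewrite /bern exchange_big/=; apply: eq_bigr => nu _; rewrite mulr_sumr.
Qed.

Lemma bern1 (R : realType) N (z : Cplx R) : bern N (fun=> 1) z = 1.
Proof.
have := exprDn (1 - z) z N; rewrite subrK expr1n => E; rewrite [RHS]E /bern big_mkord.
by apply: eq_bigr => nu _; rewrite mulr1 -mulr_natl; ring.
Qed.

Lemma bern_shift (R : realType) N (F : nat -> Cplx R) z :
  bern N (fun nu => nu%:R * F nu) z =
  N%:R * z * bern N.-1 (fun nu => F nu.+1) z.
Proof.
case: N => [|N].
  by rewrite /bern big_nat1 !mul0r mulr0.
rewrite /bern big_nat_recl//= mul0r mulr0 add0r mulr_sumr.
apply: eq_bigr => nu _; rewrite subSS exprS.
have := mul_bin_diag N.+1 nu => /(congr1 (fun n => n%:R : Cplx R)).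
rewrite !natrM/= => E.
transitivity (nu.+1%:R * 'C(N.+1, nu.+1)%:R *
  (z * z ^+ nu * (1 - z) ^+ (N - nu) * F nu.+1)); first by ring.
by rewrite -E; ring.
Qed.

(** One factor b + t nu is split off; its nu is absorbed by nu C(N, nu) = N C(N-1, nu-1), which
    shifts the base point to b + t. *)
Lemma bern_momentS (R : realType) N k (b t z : Cplx R) :
  bern N (fun nu => (b + t * nu%:R) ^+ k.+1) z =
  b * bern N (fun nu => (b + t * nu%:R) ^+ k) z +
  t * N%:R * z * bern N.-1 (fun nu => (b + t + t * nu%:R) ^+ k) z.
Proof.
have -> : bern N (fun nu => (b + t * nu%:R) ^+ k.+1) z =
    bern N (fun nu => b * (b + t * nu%:R) ^+ k +
      t * (nu%:R * (b + t * nu%:R) ^+ k)) z.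
  by apply: eq_bigr => nu _; congr (_ * _); rewrite exprS; ring.
rewrite bernD !bernZ bern_shift -!mulrA; congr (_ + _ * (_ * (_ * _))).
apply: eq_bigr => nu _; congr (_ * _ ^+ _).
by rewrite -natr1; ring.
Qed.

Lemma cabs_exprB_le (R : realType) (B : R) (x y : Cplx R) k :
  1 <= B -> cabs x <= B -> cabs y <= B ->
  cabs (x ^+ k - y ^+ k) <= k%:R * B ^+ k * cabs (x - y).
Proof.
move=> B1 xB yB; elim: k => [|k IH]; first by rewrite subrr cabs0 mul0r mul0r.
have -> : x ^+ k.+1 - y ^+ k.+1 = x * (x ^+ k - y ^+ k) + y ^+ k * (x - y).
  by rewrite !exprS; ring.
apply: le_trans (cabsD _ _) _; rewrite !cabsM cabsX.
have yk : cabs y ^+ k <= B ^+ k.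
  by rewrite lerXn2r ?nnegrE ?cabs_ge0//; lra.
have Bk : 0 <= B ^+ k by rewrite exprn_ge0//; lra.
have d0 := cabs_ge0 (x - y).
have h1 : cabs x * cabs (x ^+ k - y ^+ k) <= B * (k%:R * B ^+ k * cabs (x - y)).
  by apply: ler_pM; rewrite ?cabs_ge0.
have h2 : cabs y ^+ k * cabs (x - y) <= B * B ^+ k * cabs (x - y).
  by rewrite ler_wpM2r//; nra.
by rewrite -natr1 exprS; lra.
Qed.

(** The hypothesis on B survives the passage from (N + 1, b) to (N, b + t) because rho >= 1, so the
    induction on k runs over all N and b. The square arises from k^2 + k <= (k + 1)^2, each step
    adding an error linear in k. *)
Lemma bern_moment_le (R : realType) (rho B : R) N k (b t z : Cplx R) :
  1 <= rho -> cabs z <= rho -> 1 <= B -> cabs b + N%:R * cabs t * rho <= B ->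
  cabs (bern N (fun nu => (b + t * nu%:R) ^+ k) z - (b + t * N%:R * z) ^+ k)
    <= k%:R ^+ 2 * B ^+ k * ((1 + rho) * cabs t).
Proof.
move=> rho1 zr B1; elim: k N b => [|k IH] N b bB.
  rewrite (_ : bern _ _ _ = 1); last exact: bern1.
  by rewrite subrr cabs0 expr0n/= !mul0r.
rewrite bern_momentS.
set X := bern N _ z; set Y := bern N.-1 _ z; set P := b + t * N%:R * z.
have -> : b * X + t * N%:R * z * Y - P ^+ k.+1 =
    b * (X - P ^+ k) + t * N%:R * z * (Y - P ^+ k) by rewrite exprS /P; ring.
apply: le_trans (cabsD _ _) _; rewrite !cabsM cabs_nat.
have t0 := cabs_ge0 t; have b0 := cabs_ge0 b; have z0 := cabs_ge0 z.
have N0 : 0 <= N%:R * cabs t by rewrite mulr_ge0.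
pose e := B ^+ k * ((1 + rho) * cabs t).
have e0 : 0 <= e by rewrite !mulr_ge0 ?exprn_ge0//; lra.
have hX : cabs (X - P ^+ k) <= k%:R ^+ 2 * e by rewrite mulrA; exact: IH.
have Nz : N%:R * cabs t * cabs z <= N%:R * cabs t * rho by rewrite ler_wpM2l.
have hY : N%:R * cabs t * cabs (Y - P ^+ k) <=
    N%:R * cabs t * ((k%:R ^+ 2 + k%:R) * e).
  case: N @X @Y @P bB {hX N0} Nz => [|N] X Y P bB Nz; first by rewrite !mul0r.
  rewrite ler_wpM2l ?mulr_ge0//.
  have bB' : cabs (b + t) + N%:R * cabs t * rho <= B.
    have := cabsD b t; move: bB; rewrite -natr1; nra.
  have := IH _ _ bB'; rewrite -/Y; set Q := b + t + t * N%:R * z.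
  rewrite -[leRHS]mulrA -/e => hQ.
  have QB : cabs Q <= B.
    apply: le_trans (cabsD _ _) _; rewrite !cabsM cabs_nat.
    by have := mulr_ge0 (ler0n R N) t0; nra.
  have PB : cabs P <= B.
    apply: le_trans (cabsD _ _) _; rewrite !cabsM cabs_nat.
    by move: bB Nz; lra.
  (* Lowering N by one removes t z from the centre and the shift of b adds t. *)
  have QP : cabs (Q - P) <= (1 + rho) * cabs t.
    have -> : Q - P = t * (1 - z) by rewrite /Q /P -natr1; ring.
    rewrite cabsM mulrC ler_wpM2r//.
    by have := cabsD 1 (- z); rewrite cabsN cabs1; lra.
  have := cabs_exprB_le k B1 QB PB.
  have kB : 0 <= k%:R * B ^+ k by rewrite mulr_ge0 ?exprn_ge0//; lra.
  have := ler_wpM2l kB QP; have := cabs_triangle (Q ^+ k) Y (P ^+ k).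
  have -> : k%:R * B ^+ k * ((1 + rho) * cabs t) = k%:R * e by rewrite /e; ring.
  move: hQ; rewrite mulrDl; clear; lra.
have k0 := ler0n R k.
have kk : 0 <= (k%:R ^+ 2 + k%:R) * e by rewrite mulr_ge0// addr_ge0// exprn_ge0.
have h1 : cabs b * cabs (X - P ^+ k) <= cabs b * ((k%:R ^+ 2 + k%:R) * e).
  by rewrite ler_wpM2l//; apply: le_trans hX _; rewrite ler_wpM2r//; lra.
have h2 : cabs t * N%:R * cabs z * cabs (Y - P ^+ k) <=
    N%:R * cabs t * rho * ((k%:R ^+ 2 + k%:R) * e).
  have -> : cabs t * N%:R * cabs z * cabs (Y - P ^+ k) =
    cabs z * (N%:R * cabs t * cabs (Y - P ^+ k)) by ring.
  have -> : N%:R * cabs t * rho * ((k%:R ^+ 2 + k%:R) * e) =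
    rho * (N%:R * cabs t * ((k%:R ^+ 2 + k%:R) * e)) by ring.
  by apply: ler_pM; rewrite ?mulr_ge0 ?cabs_ge0.
have h3 := ler_wpM2r kk bB.
have -> : k.+1%:R ^+ 2 * B ^+ k.+1 * ((1 + rho) * cabs t) =
    B * ((k%:R + 1) ^+ 2 * e) by rewrite -natr1 /e (exprS B); ring.
apply: le_trans (lerD h1 h2) _.
rewrite -mulrDl; apply: le_trans h3 _; rewrite ler_wpM2l//; first lra.
by rewrite ler_wpM2r//; nra.
Qed.

Lemma sum_sqr_half (R : realType) m :
  \sum_(k < m) k%:R ^+ 2 / 2 ^+ k = 6 - (2 * m%:R ^+ 2 + 4 * m%:R + 6) / 2 ^+ m :> R.
Proof.
elim: m => [|m IH]; first by rewrite big_ord0 expr0; field.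
rewrite big_ord_recr/= IH (exprS 2) -natr1.
have : (2 : R) ^+ m != 0 by rewrite expf_neq0.
by move: (2 ^+ m) => x x0; field.
Qed.

(** Lets the Taylor degree m tend to infinity with everything else, including K, fixed. *)
Lemma le_half_pow (R : realType) (x c K : R) :
  (forall m : nat, x <= c + K / 2 ^+ m) -> x <= c.
Proof.
move=> h; apply/ler_addgt0Pr => e e0.
have := archi_boundP (divr_ge0 (normr_ge0 K) (ltW e0)).
move: (Num.bound _) => m; rewrite ltr_pdivrMr// => hm.
apply: le_trans (h m) _; rewrite lerD2l ler_pdivrMr ?exprn_gt0//.
have m2 : m%:R <= 2 ^+ m :> R by rewrite -natrX ler_nat ltnW// ltn_expl.
by have := ler_norm K; nra.
Qed.

Lemma cabs_bern_le (R : realType) N (F : nat -> Cplx R) z :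
  cabs (bern N F z) <=
  \sum_(0 <= nu < N.+1) 'C(N, nu)%:R * cabs z ^+ nu * cabs (1 - z) ^+ (N - nu)
    * cabs (F nu).
Proof.
apply: le_trans (cabs_sum _ _ _) _; apply: ler_sum => nu _.
by rewrite !cabsM !cabsX cabs_nat.
Qed.

Lemma bernstein_entire (R : realType) (G : Cplx R -> Cplx R) : entire G ->
  exists2 C : R, 0 < C & forall (b eps : R) (N : nat) z,
    (0 < N)%N -> 0 <= eps <= 1 -> `|b| <= 2^-1 -> cabs z <= 3 / 2 ->
    cabs (PN (fun x => G (RtoC x)) b eps N z - G (z + RtoC b)) <=
      C * (N%:R^-1 + eps).
Proof.
move=> /taylor[a [M M0 [aM hG]]]; exists (15 * M); first lra.
move=> b eps N z N0 /andP[eps0 eps1] b2 z2.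
pose t := (1 - eps) / N%:R; have N0' : 0 < N%:R :> R by rewrite ltr0n.
have t0 : 0 <= t by rewrite divr_ge0//; lra.
have Nt : N%:R * t = 1 - eps by rewrite /t mulrCA divff ?mulr1// lt0r_neq0.
have tN : t <= N%:R^-1 by rewrite /t ler_piMl ?invr_ge0//; lra.
pose x nu : R := b + nu%:R * t.
have x2 nu : (nu <= N)%N -> cabs (RtoC (x nu)) <= 2.
  move=> nuN; rewrite cabs_real /x; apply: le_trans (ler_normD _ _) _.
  have : nu%:R * t <= N%:R * t by rewrite ler_wpM2r// ler_nat.
  rewrite (ger0_norm (mulr_ge0 _ t0))// Nt; lra.
have [nu|Cx hCx] := @choice nat R (fun nu C => (nu <= N)%N -> forall m,
    cabs (G (RtoC (x nu)) - \sum_(k < m.+1) a k * RtoC (x nu) ^+ k)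
      <= C / 2 ^+ m).
  have [nuN|_] := leqP nu N; last by exists 0.
  by have [C _ h] := hG _ (x2 _ nuN); exists C.
pose w := z + RtoC b.
have w2 : cabs w <= 2.
  by apply: le_trans (cabsD _ _) _; rewrite cabs_real; lra.
have [Cw _ hCw] := hG _ w2.
(* K may be exponentially large in N; it is always divided by 2^m, with m unbounded. *)
pose K := \sum_(0 <= nu < N.+1)
  'C(N, nu)%:R * cabs z ^+ nu * cabs (1 - z) ^+ (N - nu) * Cx nu.
apply: (@le_half_pow _ _ _ (K + Cw)) => m.
pose T y : Cplx R := \sum_(k < m.+1) a k * y ^+ k.
have hK : cabs (bern N (fun nu => G (RtoC (x nu)) - T (RtoC (x nu))) z)
    <= K / 2 ^+ m.
  apply: le_trans (cabs_bern_le _ _ _) _; rewrite /K mulr_suml.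
  rewrite !big_mkord; apply: ler_sum => nu _; rewrite -[leRHS]mulrA.
  rewrite ler_wpM2l ?hCx//; last by rewrite -ltnS.
  by rewrite !mulr_ge0 ?exprn_ge0 ?cabs_ge0.
pose mom k := bern N (fun nu => (RtoC b + RtoC t * nu%:R) ^+ k) z.
have PE : PN (fun x => G (RtoC x)) b eps N z =
    bern N (fun nu => G (RtoC (x nu)) - T (RtoC (x nu))) z +
    \sum_(k < m.+1) a k * mom k.
  have -> : \sum_(k < m.+1) a k * mom k = bern N (fun nu => T (RtoC (x nu))) z.
    rewrite /T (@bern_sum R N m.+1 (fun k nu => a k * RtoC (x nu) ^+ k)).
    apply: eq_bigr => k _; rewrite bernZ; congr (_ * _).
    apply: eq_bigr => nu _; congr (_ * _ ^+ _).
    by rewrite /x /RtoC rmorphD [in RHS]rmorphM rmorph_nat [in RHS]mulrC.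
  by rewrite -bernD; apply: eq_bigr => nu _; rewrite subrK.
have momE k : cabs (mom k - w ^+ k) <=
    k%:R ^+ 2 * 2 ^+ k * (5 / 2 * (N%:R^-1 + eps)).
  have hB : cabs (RtoC b) + N%:R * cabs (RtoC t) * (3 / 2) <= 2.
    by rewrite !cabs_real (ger0_norm t0) Nt; lra.
  have h := @bern_moment_le R (3 / 2) 2 N k (RtoC b) (RtoC t) z
    ltac:(lra) z2 ltac:(lra) hB.
  set P := RtoC b + _ in h.
  have PB : cabs P <= 2.
    apply: le_trans (cabsD _ _) _; move: hB; rewrite !cabsM cabs_nat.
    have := mulr_ge0 (ltW N0') (cabs_ge0 (RtoC t)); nra.
  have Pw : cabs (P - w) <= 3 / 2 * eps.
    have -> : P - w = - RtoC eps * z.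
      have NtC : RtoC t * N%:R = 1 - RtoC eps :> Cplx R.
        have : RtoC (N%:R * t) = RtoC (1 - eps) by rewrite Nt.
        rewrite /RtoC [in RHS]rmorphB rmorph1 => <-.
        by rewrite [in RHS]rmorphM rmorph_nat mulrC.
      by rewrite /P /w NtC; ring.
    rewrite cabsM cabsN cabs_real ger0_norm//; nra.
  have h2 := @cabs_exprB_le R 2 P w k ltac:(lra) PB w2.
  have kk : k%:R <= k%:R ^+ 2 :> R by rewrite -natrX ler_nat; case: (k) => // n; rewrite leq_pmulr.
  have p2 : 0 <= 2 ^+ k :> R by rewrite exprn_ge0.
  have h3 : k%:R * 2 ^+ k * cabs (P - w) <= k%:R ^+ 2 * 2 ^+ k * (3 / 2 * eps).
    by apply: ler_pM; rewrite ?cabs_ge0 ?mulr_ge0// ler_wpM2r.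
  have h4 : k%:R ^+ 2 * 2 ^+ k * ((1 + 3 / 2) * cabs (RtoC t)) <=
      k%:R ^+ 2 * 2 ^+ k * (5 / 2 * N%:R^-1).
    rewrite ler_wpM2l ?mulr_ge0 ?exprn_ge0// cabs_real ger0_norm//; lra.
  have := cabs_triangle (P ^+ k) (mom k) (w ^+ k).
  have : 0 <= k%:R ^+ 2 * 2 ^+ k * eps by rewrite !mulr_ge0 ?exprn_ge0.
  move: h h2 h3 h4; rewrite -/(mom k); clear; lra.
rewrite PE; set X := bern _ _ _ in hK *.
have -> : X + \sum_(k < m.+1) a k * mom k - G (z + RtoC b) =
    X + \sum_(k < m.+1) a k * (mom k - w ^+ k) - (G w - T w).
  have -> : \sum_(k < m.+1) a k * (mom k - w ^+ k) =
      \sum_(k < m.+1) a k * mom k - T w.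
    by rewrite /T -sumrB; apply: eq_bigr => k _; exact: mulrBr.
  by rewrite -/w; ring.
apply: le_trans (cabsD _ _) _; rewrite cabsN.
have := cabsD X (\sum_(k < m.+1) a k * (mom k - w ^+ k)).
have : cabs (\sum_(k < m.+1) a k * (mom k - w ^+ k)) <=
    15 * M * (N%:R^-1 + eps).
  apply: le_trans (cabs_sum _ _ _) _.
  set d := N%:R^-1 + eps; have d0 : 0 <= d by rewrite addr_ge0// invr_ge0 ltW.
  apply: (@le_trans _ _ (\sum_(k < m.+1) k%:R ^+ 2 / 2 ^+ k * (M * (5 / 2 * d)))).
    apply: ler_sum => k _; rewrite cabsM.
    have -> : k%:R ^+ 2 / 2 ^+ k * (M * (5 / 2 * d)) =
        (M / 4 ^+ k) * (k%:R ^+ 2 * 2 ^+ k * (5 / 2 * d)).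
      have -> : (4 : R) ^+ k = 2 ^+ k * 2 ^+ k by rewrite -exprMn; congr (_ ^+ _); ring.
      have : (2 : R) ^+ k != 0 by rewrite expf_neq0.
      by move: (2 ^+ k) => y y0; field.
    by apply: ler_pM; rewrite ?cabs_ge0.
  rewrite -mulr_suml sum_sqr_half.
  have q0 : 0 <= (2 * m.+1%:R ^+ 2 + 4 * m.+1%:R + 6) / 2 ^+ m.+1 :> R.
    by rewrite divr_ge0 ?exprn_ge0// !addr_ge0 ?mulr_ge0 ?exprn_ge0.
  have Md : 0 <= M * (5 / 2 * d) by rewrite !mulr_ge0//; lra.
  by have := mulr_ge0 q0 Md; lra.
have := hCw m; rewrite -/(T w) mulrDl; lra.
Qed.

(** * Exponentially small tails *)

Lemma bounded_on_reals (R : realType) (G : Cplx R -> Cplx R) : entire G ->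
  exists2 M : R, 0 < M & forall x : R, `|x| <= 2 -> cabs (G (RtoC x)) <= M.
Proof.
move=> dG.
have inH z : halfplane (0 : Cplx R) 0 z by rewrite /halfplane/= mul0r.
have cG (c : Cplx R) : halfplane 0 0 c -> {for c, continuous G}.
  by move=> _; apply: differentiable_continuous; apply/derivable1_diffP.
have [M M0 hM] := segment_bounded cG (inH (RtoC (-2))) (inH (RtoC 2)).
exists M => // x; rewrite ler_norml => /andP[x1 x2].
have -> : RtoC x = RtoC (-2) + RtoC ((x + 2) / 4) * (RtoC 2 - RtoC (-2)).
  by rewrite /RtoC -rmorphB -rmorphM -rmorphD; congr (RtoC _); field.
by apply: hM; apply/andP; split; lra.
Qed.

Lemma pow34_le (R : realType) N : (0 < N)%N -> (3 / 4) ^+ N <= 3 * N%:R^-1 :> R.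
Proof.
move=> N0; rewrite ler_pdivlMr ?ltr0n//.
(* The shift by 3 makes the left side nonincreasing from n = 0, with value 3 there. *)
have main n : (3 / 4) ^+ n * (n%:R + 3) <= 3 :> R.
  elim: n => [|n IH]; first by rewrite mul1r add0r.
  have p0 : 0 <= (3 / 4) ^+ n :> R by rewrite exprn_ge0//; lra.
  have := mulr_ge0 p0 (ler0n R n); move: IH; rewrite exprS -natr1; lra.
have := main N; have : 0 <= (3 / 4) ^+ N :> R by rewrite exprn_ge0//; lra.
lra.
Qed.

(* A Chernoff bound: inserting the factor [2 ^ (m * i) >= 2 ^ N] into the terms
   with [N <= m * i], where [i] is [nu] or [N - nu], completes a binomial sum. *)
Lemma bern_tail (R : realType) (N m : nat) (M : R) (F : nat -> Cplx R) z :
  (0 < N)%N -> 0 <= M -> (forall nu, (nu <= N)%N -> cabs (F nu) <= M) ->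
  (cabs z <= (4 * 2 ^+ m)^-1 /\
     (forall nu, (nu <= N)%N -> F nu != 0 -> (N <= m * nu)%N)) \/
  (cabs (1 - z) <= (4 * 2 ^+ m)^-1 /\
     (forall nu, (nu <= N)%N -> F nu != 0 -> (N <= m * (N - nu))%N)) ->
  cabs (bern N F z) <= 3 * M * N%:R^-1.
Proof.
move=> N0 M0 FM hz.
suff main : cabs (bern N F z) <= M * (3 / 4) ^+ N.
  by have := ler_wpM2l M0 (pow34_le R N0); lra.
have m2 : 1 <= 2 ^+ m :> R by rewrite exprn_ege1// ler1n.
have q4 : (4 * 2 ^+ m)^-1 <= 4^-1 :> R by rewrite lef_pV2 ?posrE; lra.
have two_pow i : (N <= m * i)%N -> 2 ^+ N <= (2 ^+ m) ^+ i :> R.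
  by move=> h; rewrite -exprM ler_weXn2l// ler1n.
(* Here x and y are |z| and |1 - z|, the smaller one multiplied by 2^m: they are at most 1/4 and
   5/4, and the completed sum gives (3 / 2)^N / 2^N. *)
have fin (x y : R) : 0 <= x -> 0 <= y -> x + y <= 3 / 2 ->
    (forall nu, (nu <= N)%N -> F nu != 0 ->
       2 ^+ N * (cabs z ^+ nu * cabs (1 - z) ^+ (N - nu)) <= x ^+ nu * y ^+ (N - nu)) ->
    cabs (bern N F z) <= M * (3 / 4) ^+ N.
  move=> x0 y0 xy h.
  have p2 : 0 < 2 ^+ N :> R by rewrite exprn_gt0.
  have -> : (3 / 4) ^+ N = (3 / 2) ^+ N / 2 ^+ N :> R.
    by rewrite -expr_div_n; congr (_ ^+ _); field.
  rewrite mulrA ler_pdivlMr//.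
  apply: (@le_trans _ _ (M * (y + x) ^+ N)); last first.
    by rewrite ler_wpM2l// lerXn2r ?nnegrE; lra.
  rewrite (exprDn y x) mulr_sumr.
  have := ler_wpM2r (ltW p2) (cabs_bern_le N F z); move/le_trans; apply.
  rewrite mulr_suml big_mkord; apply: ler_sum => nu _.
  have nuN : (nu <= N)%N by rewrite -ltnS.
  have [->|Fn] := eqVneq (F nu) 0.
    by rewrite cabs0 mulr0 mul0r mulr_ge0// mulrn_wge0// mulr_ge0 ?exprn_ge0.
  have := h _ nuN Fn; have := FM _ nuN.
  rewrite -[X in _ -> _ -> _ <= M * X]mulr_natr.
  set a := cabs z ^+ nu; set b := cabs (1 - z) ^+ _; set c := 'C(N, nu)%:R.
  move=> h1 h2.
  have -> : c * a * b * cabs (F nu) * 2 ^+ N = cabs (F nu) * (2 ^+ N * (a * b) * c).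
    by ring.
  have ab : 0 <= 2 ^+ N * (a * b) by rewrite !mulr_ge0 ?exprn_ge0 ?cabs_ge0.
  have c0 : 0 <= c by exact: ler0n.
  apply: ler_pM; rewrite ?cabs_ge0//; first exact: mulr_ge0.
  by rewrite ler_wpM2r// [leRHS]mulrC.
case: hz => -[hz hF].
- have z1 : cabs (1 - z) <= 5 / 4.
    by have := cabsD 1 (- z); rewrite cabsN cabs1; lra.
  apply: (fin (2 ^+ m * cabs z) (cabs (1 - z))); rewrite ?mulr_ge0 ?cabs_ge0//.
  + suff : 2 ^+ m * cabs z <= 4^-1 by lra.
    apply: le_trans (ler_wpM2l _ hz) _; first lra.
    by rewrite invfM mulrCA divff ?mulr1// lt0r_neq0//; lra.
  + move=> nu nuN /(hF _ nuN)/two_pow h; rewrite exprMn -[leRHS]mulrA.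
    by rewrite ler_wpM2r// mulr_ge0 ?exprn_ge0 ?cabs_ge0.
- have z1 : cabs z <= 5 / 4.
    have := cabsD 1 (- (1 - z)); rewrite cabsN cabs1 opprB addrCA subrr addr0; lra.
  apply: (fin (cabs z) (2 ^+ m * cabs (1 - z))); rewrite ?mulr_ge0 ?cabs_ge0//.
  + suff : 2 ^+ m * cabs (1 - z) <= 4^-1 by lra.
    apply: le_trans (ler_wpM2l _ hz) _; first lra.
    by rewrite invfM mulrCA divff ?mulr1// lt0r_neq0//; lra.
  + move=> nu nuN /(hF _ nuN)/two_pow h; rewrite exprMn mulrCA.
    by rewrite ler_wpM2l ?exprn_ge0 ?cabs_ge0// ler_wpM2r// exprn_ge0 ?cabs_ge0.
Qed.

(** * The piecewise function and uniform convergence *)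

Lemma bernstein_gpm (R : realType) (Gm Gp : Cplx R -> Cplx R) (eta : R) :
  entire Gm -> entire Gp -> 0 < eta < 2^-1 ->
  exists r C d : R, [/\ 0 < r, 0 < C, 0 < d &
    forall (b eps : R) N z, (0 < N)%N -> 0 <= eps < 1 -> eps <= d ->
      - eta <= b <= eta ->
      (cabs z < r -> cabs (PN (gpm Gm Gp) b eps N z - Gm (z + RtoC b)) <=
         C * (N%:R^-1 + eps)) /\
      (cabs (1 - z) < r -> cabs (PN (gpm Gm Gp) b eps N z - Gp (z + RtoC b)) <=
         C * (N%:R^-1 + eps))].
Proof.
move=> hGm hGp /andP[eta0 eta2].
have [Cm Cm0 hCm] := bernstein_entire hGm.
have [Cp Cp0 hCp] := bernstein_entire hGp.
have [Mm Mm0 hMm] := bounded_on_reals hGm.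
have [Mp Mp0 hMp] := bounded_on_reals hGp.
(* [2 * d] is the margin 1/2 - eta: a node beyond 1/2 has nu t >= 2 d, one before it has nu t <= 1 -
   2 d. With m d >= 1 this yields N <= m nu, resp. N <= m (N - nu), as [bern_tail] expects; the
   radius depends only on m, hence is uniform in b and eps. *)
pose d := (2^-1 - eta) / 2; have d0 : 0 < d by rewrite /d; lra.
have [m dm] : exists m : nat, 1 <= m%:R * d.
  have := archi_boundP (ltW (divr_gt0 ltr01 d0)); move: (Num.bound _) => m.
  by rewrite ltr_pdivrMr// => h; exists m; apply: ltW.
pose r : R := (4 * 2 ^+ m)^-1.
have m2 : 1 <= 2 ^+ m :> R by rewrite exprn_ege1// ler1n.
have r0 : 0 < r by rewrite invr_gt0; lra.
have r4 : r <= 4^-1 by rewrite lef_pV2 ?posrE; lra.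
exists r, (Cm + Cp + 3 * (Mm + Mp)), d; split=> //; first lra.
move=> b eps N z N0 /andP[eps0 eps1] epsd /andP[b1 b2].
have N0' : 0 < N%:R :> R by rewrite ltr0n.
have bb : `|b| <= 2^-1 by rewrite ler_norml; apply/andP; split; lra.
have ee : 0 <= eps <= 1 by rewrite eps0 ltW.
pose t := (1 - eps) / N%:R.
have t0 : 0 <= t by rewrite divr_ge0//; lra.
have Nt : N%:R * t = 1 - eps by rewrite /t mulrCA divff ?mulr1// lt0r_neq0.
pose x nu : R := b + nu%:R * t.
have x2 nu : (nu <= N)%N -> `|x nu| <= 2.
  move=> nuN; have : nu%:R * t <= N%:R * t by rewrite ler_wpM2r// ler_nat.
  have := mulr_ge0 (ler0n R nu) t0.
  by rewrite Nt ler_norml /x => h1 h2; apply/andP; split; lra.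
have Ni0 : 0 < N%:R^-1 :> R by rewrite invr_gt0.
have fin G C : (forall b eps N z, (0 < N)%N -> 0 <= eps <= 1 -> `|b| <= 2^-1 ->
      cabs z <= 3 / 2 ->
      cabs (PN (fun x => G (RtoC x)) b eps N z - G (z + RtoC b)) <=
      C * (N%:R^-1 + eps)) -> 0 < C -> C <= Cm + Cp -> cabs z <= 3 / 2 ->
    cabs (bern N (fun nu => gpm Gm Gp (x nu) - G (RtoC (x nu))) z) <=
      3 * (Mm + Mp) * N%:R^-1 ->
    cabs (PN (gpm Gm Gp) b eps N z - G (z + RtoC b)) <=
      (Cm + Cp + 3 * (Mm + Mp)) * (N%:R^-1 + eps).
  move=> hG C0 CC z2; have := hG _ _ _ _ N0 ee bb z2.
  have -> : PN (gpm Gm Gp) b eps N z - G (z + RtoC b) =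
      bern N (fun nu => gpm Gm Gp (x nu) - G (RtoC (x nu))) z +
      (PN (fun x => G (RtoC x)) b eps N z - G (z + RtoC b)).
    rewrite addrA; congr (_ - _); rewrite -bernD.
    by apply: eq_bigr => nu _; rewrite subrK.
  move=> h1 h2; apply: le_trans (cabsD _ _) _.
  have : C * (N%:R^-1 + eps) <= (Cm + Cp) * (N%:R^-1 + eps).
    by rewrite ler_wpM2r//; lra.
  have : 0 <= (Mm + Mp) * eps by rewrite mulr_ge0//; lra.
  lra.
have gM nu : (nu <= N)%N -> forall G, G = Gm \/ G = Gp ->
    cabs (gpm Gm Gp (x nu) - G (RtoC (x nu))) <= Mm + Mp.
  move=> /x2 h G; have hm := hMm _ h; have hp := hMp _ h.
  have := cabs_ge0 (Gm (RtoC (x nu))); have := cabs_ge0 (Gp (RtoC (x nu))) => ? ?.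
  have := cabsD (Gp (RtoC (x nu))) (- Gm (RtoC (x nu))); rewrite cabsN => ?.
  rewrite /gpm; case: ifP => _ [->|->]; rewrite ?subrr ?cabs0; try lra.
  by rewrite cabsB; lra.
have MM : 0 <= Mm + Mp by lra.
split => hz.
  apply: (fin Gm Cm hCm) => //; [lra|lra|].
  apply: (@bern_tail _ _ m) => //; first by move=> nu /gM; apply; left.
  left; split; first exact: ltW.
  move=> nu nuN; rewrite /gpm; case: ltP; first by rewrite subrr eqxx.
  rewrite /x => hx _; rewrite -(ler_nat R) natrM.
  have tN : N%:R * (nu%:R * t) <= nu%:R.
    rewrite mulrCA Nt; have := mulr_ge0 (ler0n R nu) eps0; lra.
  have h1 : 2 * d <= nu%:R * t by rewrite /d; lra.
  have h2 : N%:R * (2 * d) <= nu%:R.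
    by apply: le_trans tN; rewrite ler_wpM2l// ltW.
  have := ler_wpM2l (ler0n R m) h2; have := ler_wpM2l (ltW N0') dm; lra.
have z2 : cabs z <= 3 / 2.
  have := cabsD 1 (- (1 - z)); rewrite cabsN cabs1 opprB addrCA subrr addr0; lra.
apply: (fin Gp Cp hCp) => //; first lra.
apply: (@bern_tail _ _ m) => //; first by move=> nu /gM; apply; right.
right; split; first exact: ltW.
move=> nu nuN; rewrite /gpm; case: ltP; last by rewrite subrr eqxx.
rewrite /x => hx _; rewrite -(ler_nat R) natrM natrB//.
(* The nodes stop at b + 1 - eps instead of b + 1. Half of the margin 2 d pays for this through eps
   <= d, leaving N - nu >= N d. *)
have h1 : nu%:R * t <= 1 - 2 * d by rewrite /d; lra.
have h2 : nu%:R * (1 - eps) <= N%:R * (1 - 2 * d).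
  by rewrite -Nt mulrCA ler_wpM2l// ltW.
have nuN' : nu%:R <= N%:R :> R by rewrite ler_nat.
have h3 : nu%:R * eps <= N%:R * d by rewrite ler_pM.
have h4 : N%:R * d <= N%:R - nu%:R by lra.
have := ler_wpM2l (ler0n R m) h4; have := ler_wpM2l (ltW N0') dm; lra.
Qed.

Lemma open_disc (R : realType) (c : Cplx R) (r : R) :
  open [set z | cabs (c - z) < r].
Proof.
rewrite openE => z /= hz; apply/nbhs_cabs; exists (r - cabs (c - z)).
  by rewrite subr_gt0.
move=> y hy /=; have := cabs_triangle z c y; rewrite (cabsB z y); lra.
Qed.

Lemma unif_conv_of_rate (R : realType) (I : Type) (g : R -> Cplx R)
    (eps : I -> nat -> R) (G : Cplx R -> Cplx R) (eta C d : R) K :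
  (forall i N, (0 < N)%N -> 0 <= eps i N < 1) -> sup_to_0 eps ->
  0 < C -> 0 < d ->
  (forall (b e : R) N z, (0 < N)%N -> 0 <= e < 1 -> e <= d ->
     - eta <= b <= eta -> K z ->
     cabs (PN g b e N z - G (z + RtoC b)) <= C * (N%:R^-1 + e)) ->
  unif_conv g eps G eta K.
Proof.
move=> eps01 sup0 C0 d0 rate e e0.
(* Both 1 / N and eps will be at most e1, so the error is at most 2 e / 3, strictly below e. *)
pose e1 := Num.min d (e / (3 * C)).
have e10 : 0 < e1 by rewrite lt_min d0 divr_gt0// mulr_gt0.
have e1d : e1 <= d by rewrite ge_min lexx.
have e1e : C * e1 <= e / 3.
  have : e1 <= e / (3 * C) by rewrite ge_min lexx orbT.
  by rewrite ler_pdivlMr ?mulr_gt0//; lra.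
have [N1 hN1] := sup0 _ e10.
have := archi_boundP (ltW (divr_gt0 ltr01 e10)).
move: (Num.bound _) => N2; rewrite ltr_pdivrMr// => hN2.
exists (maxn N1 N2).+1 => N hN b hb i z Kz.
have N0 : (0 < N)%N by apply: leq_trans hN.
have N1N : (N1 <= N)%N by rewrite (leq_trans _ (ltnW hN))// leq_maxl.
have N2N : (N2 <= N)%N by rewrite (leq_trans _ (ltnW hN))// leq_maxr.
have hi := hN1 _ N1N i.
rewrite normE ltcR.
apply: le_lt_trans (rate _ _ _ _ N0 (eps01 i _ N0) (le_trans hi e1d) hb Kz) _.
have NN : N%:R^-1 <= e1.
  rewrite -[leLHS]mul1r ler_pdivrMr ?ltr0n//.
  have : N2%:R <= N%:R :> R by rewrite ler_nat.
  by move=> /(ler_wpM2r (ltW e10)); lra.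
have := ler_wpM2l (ltW C0) NN; have := ler_wpM2l (ltW C0) hi; lra.
Qed.

Theorem mainTheorem3 (R : realType) (Gm Gp : Cplx R -> Cplx R)
  (hGm : entire Gm) (hGp : entire Gp)
  (hval : Gm (RtoC (2^-1)) = Gp (RtoC (2^-1)))
  (hder : derive1 Gm (RtoC (2^-1)) != derive1 Gp (RtoC (2^-1)))
  (eta : R) (heta : 0 < eta < 2^-1) :
  exists (Vm Vp : set (Cplx R)),
    [/\ (open Vm /\ Vm 0), (open Vp /\ Vp 1),
      (* single sequence eps *)
      (forall eps : nat -> R, admissible_eps eps ->
         (forall K, compact K -> K `<=` Vm ->
            unif_conv (gpm Gm Gp) (fun _ : unit => eps) Gm eta K) /\
         (forall K, compact K -> K `<=` Vp ->
            unif_conv (gpm Gm Gp) (fun _ : unit => eps) Gp eta K)) &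
      (* families of sequences, with sup_iota eps_iota,N -> 0 *)
      (forall (I : Type) (eps : I -> nat -> R),
         (forall i, admissible_eps (eps i)) -> sup_to_0 eps ->
         (forall K, compact K -> K `<=` Vm ->
            unif_conv (gpm Gm Gp) eps Gm eta K) /\
         (forall K, compact K -> K `<=` Vp ->
            unif_conv (gpm Gm Gp) eps Gp eta K))].
Proof.
have [r [C [d [r0 C0 d0 rate]]]] := bernstein_gpm hGm hGp heta.
pose Vm := [set z : Cplx R | cabs (0 - z) < r].
pose Vp := [set z : Cplx R | cabs (1 - z) < r].
have family (I : Type) (eps : I -> nat -> R) :
    (forall i, admissible_eps (eps i)) -> sup_to_0 eps ->
    (forall K, compact K -> K `<=` Vm -> unif_conv (gpm Gm Gp) eps Gm eta K) /\
    (forall K, compact K -> K `<=` Vp -> unif_conv (gpm Gm Gp) eps Gp eta K).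
  move=> adm sup0; split=> K _ KV;
    apply: (unif_conv_of_rate (fun i => proj1 (adm i)) sup0 C0 d0);
    move=> b e N z N0 e01 ed hb /KV.
    by rewrite /Vm/= sub0r cabsN; exact: (rate _ _ _ _ N0 e01 ed hb).1.
  by exact: (rate _ _ _ _ N0 e01 ed hb).2.
exists Vm, Vp; split; [|..|exact: family].
- by split; [exact: open_disc|rewrite /Vm /mkset subrr cabs0].
- by split; [exact: open_disc|rewrite /Vp /mkset subrr cabs0].
(* A single sequence is a family indexed by [unit], for which convergence to 0 is the supremum
   condition. *)
move=> eps adm; apply: family => // e e0.
have [_ /cvgrPdist_le/(_ e e0)[N0 _ h]] := adm.
exists N0 => N /h; rewrite sub0r normrN => {}h _.
exact: le_trans (ler_norm _) h.
Qed.
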